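(* Let $n\geq 2$ and $m\geq 2$ be integers. Let $W\in C^2(\mathbb{R}^m;\mathbb{R})$, and suppose there exist $N\in\mathbb{N}$ (so $N \ge 1$) and points $a_1,\dots,a_N\in\mathbb{R}^m$ such that $W(a_i)=0$ for $i=1,\dots,N$, $W(v)>0$ for every $v\in\mathbb{R}^m\setminus\{a_1,\dots,a_N\}$, and $W_{uu}(a_i)\nu\cdot\nu>0$ for every $\nu\in\mathbb{S}^{m-1}$ and every $i=1,\dots,N$. Let $u\in C^2(\mathbb{R}^n;\mathbb{R}^m)$ be a nonconstant, bounded solution of the elliptic system $$\Delta u=W_u(u)\quad\text{in } \mathbb{R}^n .$$ Then, for every $x\in\mathbb{R}^n$ and every real $k>0$, $$\frac{1}{(\ln r)^k}\,\frac{1}{r^{n-2}}\int_{B(x,r)}\left\{\frac12|\nabla u|^2+W(u)\right\}dy\;\to\;\infty\quad\text{as } r\to\infty .$$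
   Context: Here $W_u$ denotes the gradient of $W:\mathbb{R}^m\to\mathbb{R}$ and $W_{uu}$ its Hessian matrix; $\cdot$ is the Euclidean inner product in $\mathbb{R}^m$, and $\mathbb{S}^{m-1}$ is the unit sphere of $\mathbb{R}^m$. The Laplacian $\Delta u$ is taken componentwise, so the system reads $\Delta u_\ell=\partial_\ell W(u)$, $\ell=1,\dots,m$. $|\nabla u|^2$ is the sum of the squares of all first-order partial derivatives of all components of $u$. $B(x,r)$ is the $n$-dimensional ball of radius $r$ centered at $x$, and $|\cdot|$ is the Euclidean norm. *)

(* Defs.v *)
From HB Require Import structures.
From mathcomp Require Import all_boot all_order all_algebra.
From mathcomp Require Import all_classical all_reals all_analysis.
Import Order.TTheory GRing.Theory Num.Theory.
Import numFieldNormedType.Exports.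

Set Implicit Arguments.
Unset Strict Implicit.
Unset Printing Implicit Defensive.

Local Open Scope classical_set_scope.
Local Open Scope ring_scope.

(* The library norm on 'rV[R]_n is the sup norm, hence the explicit Euclidean
   structure below. The topologies agree, so continuity and derivatives are
   the library's. *)
Section Euclidean.
Context {R : realType} {n : nat}.
Implicit Types (x y : 'rV[R]_n) (r : R).

Definition dotv x y : R := \sum_(i < n) x 0 i * y 0 i.

Definition enorm x : R := Num.sqrt (dotv x x).

Definition eball x r : set 'rV[R]_n := [set y | enorm (y - x) < r].

End Euclidean.

Section Derivatives.
Context {R : realType} {n : nat}.
Implicit Types (i j : 'I_n) (x : 'rV[R]_n).

Definition basis_vec i : 'rV[R]_n := delta_mx 0 i.

Definition partial {V : normedModType R} i (f : 'rV[R]_n -> V) x : V :=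
  'D_(basis_vec i) f x.

Definition C1 {V : normedModType R} (f : 'rV[R]_n -> V) : Prop :=
  forall i, (forall x, derivable f x (basis_vec i)) /\
            continuous (partial i f).

Definition C2 {V : normedModType R} (f : 'rV[R]_n -> V) : Prop :=
  C1 f /\ forall i, C1 (partial i f).

Definition gradient (f : 'rV[R]_n -> R) x : 'rV[R]_n :=
  \row_i partial i f x.

Definition hessian (f : 'rV[R]_n -> R) x : 'M[R]_n :=
  \matrix_(i, j) partial i (partial j f) x.

Definition laplacian (f : 'rV[R]_n -> R) x : R :=
  \sum_(i < n) partial i (partial i f) x.

End Derivatives.

Section VectorValued.
Context {R : realType} {n m : nat}.
Implicit Types (u : 'rV[R]_n -> 'rV[R]_m) (x : 'rV[R]_n).

Definition component u (l : 'I_m) : 'rV[R]_n -> R := fun y => u y 0 l.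

Definition vlaplacian u x : 'rV[R]_m := \row_l laplacian (component u l) x.

Definition sqnorm_grad u x : R :=
  \sum_(l < m) \sum_(i < n) (partial i (component u l) x) ^+ 2.

Definition energy_density (W : 'rV[R]_m -> R) u x : R :=
  2^-1 * sqnorm_grad u x + W (u x).

End VectorValued.

(* n-dimensional Lebesgue measure, as the n-fold product of the library's
   one-dimensional one, on the product sigma-algebra of R^n. *)
Section LebesgueRn.
Context {R : realType}.
Local Open Scope ereal_scope.

Local Notation Rn n := (n.-tuple (measurableTypeR R)).

Definition cons_pair n (p : measurableTypeR R * Rn n) : Rn n.+1 :=
  [tuple of p.1 :: p.2].

Fixpoint lebesgue_Rn (n : nat) : set (Rn n) -> \bar R :=
  match n return set (Rn n) -> \bar R with
  | 0 => \d_[tuple]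
  | n'.+1 => pushforward (lebesgue_measure \x @lebesgue_Rn n') (@cons_pair n')
  end.

Lemma measurable_cons_pair n : measurable_fun setT (@cons_pair n).
Proof. exact: measurable_cons. Qed.

Definition uncons_pair n (t : Rn n.+1) : measurableTypeR R * Rn n :=
  (thead t, [tuple of behead t]).

Lemma measurable_uncons_pair n : measurable_fun setT (@uncons_pair n).
Proof.
apply/measurable_fun_pairP; split; last exact: measurable_behead.
exact: measurable_tnth.
Qed.

Lemma cons_pairK n : cancel (@cons_pair n) (@uncons_pair n).
Proof. by case=> x t; congr pair => //; apply: val_inj. Qed.

Section cons_measure.
Context n (nu : {sigma_finite_measure set (Rn n) -> \bar R}).

Definition cons_measure : set (Rn n.+1) -> \bar R :=
  pushforward (lebesgue_measure \x nu) (@cons_pair n).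

Let cons_measure0 : cons_measure set0 = 0.
Proof. by rewrite /cons_measure /pushforward preimage_set0 measure0. Qed.

Let cons_measure_ge0 A : 0 <= cons_measure A.
Proof. by apply: integral_ge0 => *; exact: measure_ge0. Qed.

Let cons_measure_sigma_additive : semi_sigma_additive cons_measure.
Proof.
have mcons := @measurable_cons_pair n.
move=> F mF tF mUF; rewrite /cons_measure /pushforward preimage_bigcup.
apply: measure_semi_sigma_additive.
- by move=> k; rewrite -[X in measurable X]setTI; exact: mcons.
- apply/trivIsetP => /= i j _ _ ij; rewrite -preimage_setI.
  by move/trivIsetP : tF => /(_ _ _ _ _ ij) ->//; rewrite preimage_set0.
- by rewrite -preimage_bigcup -[X in measurable X]setTI; exact: mcons.
Qed.

HB.instance Definition _ := isMeasure.Build _ _ _ cons_measure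
  cons_measure0 cons_measure_ge0 cons_measure_sigma_additive.

Let cons_measure_sigma_finite : sigma_finite setT cons_measure.
Proof.
have /sigma_finiteP[F [FT ndF Foo]] := sigma_finiteT (@lebesgue_measure R).
have /sigma_finiteP[G [GT ndG Goo]] := sigma_finiteT nu.
exists (fun k => @uncons_pair n @^-1` (F k `*` G k)).
  rewrite -preimage_bigcup; apply/seteqP; split => // t _.
  rewrite /preimage /=; move: (uncons_pair t) => -[x y].
  have [i _ Fix] : (\bigcup_i F i) x by rewrite -FT.
  have [j _ Gjy] : (\bigcup_i G i) y by rewrite -GT.
  exists (maxn i j) => //; split => /=.
  - by move: x Fix; exact/subsetPset/ndF/leq_maxl.
  - by move: y Gjy; exact/subsetPset/ndG/leq_maxr.
move=> k; have [mF Fk] := Foo k; have [mG Gk] := Goo k; split.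
  rewrite -[X in measurable X]setTI; apply: measurable_uncons_pair => //.
  exact: measurableX.
rewrite [ltLHS](_ : _ = (lebesgue_measure \x nu) (F k `*` G k)).
  by rewrite product_measure1E// lte_mul_pinfty// ge0_fin_numE.
congr (product_measure1 _ _ _); apply/funext => x.
by rewrite /preimage /mkset cons_pairK.
Qed.

HB.instance Definition _ := Measure_isSigmaFinite.Build _ _ _
  cons_measure cons_measure_sigma_finite.

Lemma cons_measure_ex :
  exists mu : {sigma_finite_measure set (Rn n.+1) -> \bar R},
    pushforward (lebesgue_measure \x nu) (@cons_pair n) = mu
      :> (set (Rn n.+1) -> \bar R).
Proof. by exists cons_measure. Qed.

End cons_measure.

Lemma lebesgue_Rn_measure n :
  exists mu : {sigma_finite_measure set (Rn n) -> \bar R},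
    @lebesgue_Rn n = mu :> (set (Rn n) -> \bar R).
Proof.
elim: n => [|n [nu nuE]]; first by exists \d_[tuple].
by have [mu muE] := cons_measure_ex nu; exists mu; rewrite /= nuE.
Qed.

Let lebesgue_Rn0 n : @lebesgue_Rn n set0 = 0.
Proof. by have [mu ->] := lebesgue_Rn_measure n; exact: measure0. Qed.

Let lebesgue_Rn_ge0 n A : 0 <= @lebesgue_Rn n A.
Proof. by have [mu ->] := lebesgue_Rn_measure n; exact: measure_ge0. Qed.

Let lebesgue_Rn_sigma_additive n : semi_sigma_additive (@lebesgue_Rn n).
Proof.
have [mu ->] := lebesgue_Rn_measure n.
exact: measure_semi_sigma_additive.
Qed.

HB.instance Definition _ n := isMeasure.Build _ _ _ (@lebesgue_Rn n)
  (@lebesgue_Rn0 n) (@lebesgue_Rn_ge0 n) (@lebesgue_Rn_sigma_additive n).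

Let lebesgue_Rn_sigma_finite n : sigma_finite setT (@lebesgue_Rn n).
Proof. by have [mu ->] := lebesgue_Rn_measure n; exact: sigma_finiteT. Qed.

HB.instance Definition _ n := Measure_isSigmaFinite.Build _ _ _
  (@lebesgue_Rn n) (@lebesgue_Rn_sigma_finite n).

Lemma lebesgue_Rn_box n (A : 'I_n -> set (measurableTypeR R)) :
  (forall i, measurable (A i)) ->
  @lebesgue_Rn n [set t | forall i, A i (tnth t i)] =
  \prod_(i < n) lebesgue_measure (A i).
Proof.
elim: n A => [|n IHn] A mA.
  by rewrite big_ord0 /= diracE mem_set//= => -[].
have mbox : measurable [set t : Rn n | forall i, A (lift ord0 i) (tnth t i)].
  rewrite [X in measurable X](_ : _ =
      \bigcap_(i in [set: 'I_n]) (@tnth n _ ^~ i @^-1` A (lift ord0 i))).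
    apply: fin_bigcap_measurable => [|i _]; first exact: finite_finset.
    by rewrite -[X in measurable X]setTI; exact: measurable_tnth.
  by apply/seteqP; split=> t /= h i; [move=> _|]; exact: h.
rewrite big_ord_recl -(IHn (fun i => A (lift ord0 i)))//=.
rewrite -product_measure1E//; congr (product_measure1 _ _ _).
apply/seteqP; split=> -[x t] /=.
  move=> h; split => [|i]; first by have := h ord0; rewrite tnth0.
  by have := h (lift ord0 i); rewrite tnthS.
move=> [hx ht] i; have [->|i0] := eqVneq i ord0; first by rewrite tnth0.
case: (unliftP ord0 i) i0 => [j -> _|-> /eqP//].
by rewrite tnthS.
Qed.

Definition row_of_tuple n (t : Rn n) : 'rV[R]_n := \row_i tnth t i.

Definition integral_Rn n (D : set 'rV[R]_n) (f : 'rV[R]_n -> \bar R) : \bar R :=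
  \int[@lebesgue_Rn n]_(t in @row_of_tuple n @^-1` D) f (row_of_tuple t).

End LebesgueRn.

Definition energy {R : realType} {n m : nat} (W : 'rV[R]_m -> R)
    (u : 'rV[R]_n -> 'rV[R]_m) (D : set 'rV[R]_n) : \bar R :=
  integral_Rn D (fun y => (energy_density W u y)%:E).

(* Main.v *)
(* Let e be the energy density, q = max 0 (r^2 - |y - x|^2), A(r) the integral of
   q^2 e and B(r) the integral of q e. Weights vanishing on the sphere replace
   all surface integrals by volume integrals, and A'(r) = 4 r B(r).
   - Pohozaev's identity gives (n + 2) A + 2 (integral of q^2 W(u)) <= 4 r^2 B.
   - At each well a, the function - d^-2 max(0, d - |u - a|^2)^3 has Laplacian at
     least |grad u|^2 - C W(u) close to a and at least - C W(u) everywhere, its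
     gradient is bounded by C e, and |grad u|^2 <= C W(u) away from the wells
     because u has a bounded gradient. Integrating against q^2 gives
     A <= C1 (integral of q^2 W(u)) + C2 r B.
   - Hence (n + 2 + delta) A <= (4 r^2 + C r) B with delta > 0, so that A grows at
     least like r^(n + 2 + delta / 4) and the energy in the ball, which is at least
     r^-4 A, like r^(n - 2 + delta / 4): this beats every power of ln r.
   The gradient bound on u comes from the maximum principle applied to the odd
   part of u in one variable, against an explicit quadratic barrier. *)

Require Import Defs.
From mathcomp Require Import all_boot all_order all_algebra.
From mathcomp Require Import all_classical all_reals all_analysis.
From mathcomp Require Import measurable_realfun.
From mathcomp Require Import ring lra.
Import Order.TTheory GRing.Theory Num.Theory.
Import numFieldNormedType.Exports.

Set Implicit Arguments.
Unset Strict Implicit.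
Unset Printing Implicit Defensive.

Local Open Scope classical_set_scope.
Local Open Scope ring_scope.

(** * Differential calculus along directions *)

Section DirectionalCalculus.
Context {R : realType} {n : nat}.
Implicit Types (x v : 'rV[R]_n) (f : 'rV[R]_n -> R) (s t : R).

(** Since A' = 4 r B and W is nonnegative, Pohozaev's identity alone says that r^-(n + 2) A is
    nondecreasing. Any faster growth must come from the discarded integral of q^2 W(u). The second
    inequality shows that this integral is at least A / C1 up to a term of lower order in r, hence
    delta = 2 / C1. The powers are chosen for regularity: q^2 is C^1 and the cubed well function is
    C^2, so every field that is integrated by parts has continuous derivatives and compact support,
    and Fubini's theorem with the one-dimensional fundamental theorem of calculus suffices. The
    relation A' = 4 r B is used without differentiating in r: max(0, t - z)^2 is convex in t = r^2,
    and its tangent inequality is integrated instead. The odd part of u in one variable vanishes on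
    a hyperplane, so the slope of a barrier there bounds the normal derivative of u; only bounds on
    u and on its Laplacian enter. Regularity is given through partial derivatives only; total
    differentiability, the chain rule and the symmetry of second derivatives are derived from it. *)

Lemma is_derive_along f x v s (d : R) :
  is_derive (x + s *: v) v f d <-> is_derive s 1 (fun t => f (x + t *: v)) d.
Proof.
have E : (fun h : R => h^-1 *: ((f \o shift (x + s *: v)) (h *: v) - f (x + s *: v)))
  = (fun h : R => h^-1 *: (((fun t => f (x + t *: v)) \o shift s) (h *: (1:R))
       - f (x + s *: v))).
  by apply/funext => h /=; rewrite [h *: 1]mulr1 scalerDl addrCA.
by split=> -[dv dE]; split; rewrite /derivable /derive ?E// in dv dE *;
  rewrite -?E.
Qed.

Lemma is_derive_scale1 f x v t s (d : R) :
  is_derive (x + (s * t) *: v) v f d ->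
  is_derive s 1 (fun s => f (x + (s * t) *: v)) (t * d).
Proof.
move=> /is_derive_along H.
have K : is_derive s 1 (fun s => s * t) t.
  by apply: is_derive_eq; rewrite [_ *: _]mulr0 add0r [_ *: _]mulr1.
rewrite mulrC.
exact: (is_derive1_comp (f := fun z => f (x + z *: v)) (g := fun s => s * t)).
Qed.

(** The theorem is applied on [0, 1] after rescaling by [t], so that [t] may be zero or negative. *)
Lemma MVT_along f x v t (df : 'rV[R]_n -> R) :
  (forall y, is_derive y v f (df y)) ->
  exists2 s, 0 < s < 1 & f (x + t *: v) - f x = t * df (x + (s * t) *: v).
Proof.
move=> Hf.
have D s : is_derive s 1 (fun s => f (x + (s * t) *: v))
    (t * df (x + (s * t) *: v)) by exact: is_derive_scale1.
have C : {within `[0, 1], continuous (fun s => f (x + (s * t) *: v))}.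
  by apply: derivable_within_continuous => s _; have [] := D s.
have [s] := MVT ltr01 (fun s _ => D s) C.
rewrite in_itv /= => s01; rewrite mul1r mul0r scale0r addr0 subr0 mulr1 => E.
by exists s.
Qed.

Lemma is_derive_comp1 (g : R -> R) f x v (dg df : R) :
  is_derive (f x) 1 g dg -> is_derive x v f df ->
  is_derive x v (g \o f) (dg * df).
Proof.
move=> Hg Hf.
have E : x = x + 0 *: v by rewrite scale0r addr0.
rewrite [x in is_derive x]E; apply/is_derive_along.
apply: (is_derive1_comp (f := g) (g := fun t => f (x + t *: v))).
  by rewrite -E.
by apply/is_derive_along; rewrite -E.
Qed.

End DirectionalCalculus.

Section Norms.
Context {R : realType} {n : nat}.
Implicit Types (x y : 'rV[R]_n).

Lemma coord_le_norm x i : `|x 0 i| <= `|x|.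
Proof.
rewrite [leRHS]/Num.Def.normr /= mx_normrE.
exact: (le_bigmax _ (fun ij : 'I_1 * 'I_n => `|x ij.1 ij.2|) (0, i)).
Qed.

Lemma norm_le_coord x (e : R) : 0 <= e -> (forall i, `|x 0 i| <= e) -> `|x| <= e.
Proof.
move=> e0 H; rewrite [leLHS]/Num.Def.normr /= mx_normrE; apply: bigmax_le => //.
by move=> [i j] _ /=; rewrite ord1.
Qed.

Lemma norm_lt_coord x (e : R) : 0 < e -> (forall i, `|x 0 i| < e) -> `|x| < e.
Proof.
move=> e0 H; rewrite [ltLHS]/Num.Def.normr /= mx_normrE; apply: bigmax_lt => //.
by move=> [i j] _ /=; rewrite ord1.
Qed.

End Norms.

Section Continuity.
Context {R : realType} {T : topologicalType}.
Implicit Types (f g : T -> R).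

Lemma cont_sum (I : Type) (r : seq I) (F : I -> T -> R) :
  (forall i, continuous (F i)) -> continuous (fun x => \sum_(i <- r) F i x).
Proof.
by move=> cF x; apply: cvg_big => [|i _]; [exact: add_continuous|exact: cF].
Qed.

Lemma cont_cst (c : R) : continuous (fun _ : T => c).
Proof. by move=> x; exact: cvg_cst. Qed.

Lemma cont_add f g :
  continuous f -> continuous g -> continuous (fun x => f x + g x).
Proof. by move=> cf cg x; exact: cvgD (cf x) (cg x). Qed.

Lemma cont_sub f g :
  continuous f -> continuous g -> continuous (fun x => f x - g x).
Proof. by move=> cf cg x; exact: cvgB (cf x) (cg x). Qed.

Lemma cont_mul f g :
  continuous f -> continuous g -> continuous (fun x => f x * g x).
Proof. by move=> cf cg x; exact: cvgM (cf x) (cg x). Qed.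

Lemma cont_exp f k : continuous f -> continuous (fun x => f x ^+ k).
Proof.
move=> cf; elim: k => [|k IH]; first by exact: cont_cst.
by rewrite (_ : (fun _ => _) = fun x => f x * f x ^+ k);
  [exact: cont_mul|apply/funext => x; rewrite exprS].
Qed.

Lemma cont_pos f : continuous f -> continuous (fun x => Num.max 0 (f x)).
Proof.
move=> cf x; apply: (@continuous_max _ _ (fun=> 0) f); first exact: cvg_cst.
exact: cf.
Qed.

End Continuity.

Lemma cont_coord {R : realType} {n : nat} (i : 'I_n) :
  continuous (fun x : 'rV[R]_n => x 0 i).
Proof. exact: coord_continuous. Qed.

(** * Total differentiability from continuous partial derivatives *)

Section C1.
Context {R : realType} {n : nat}.
Implicit Types (x v h : 'rV[R]_n) (f : 'rV[R]_n -> R).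

(** The points [x + trunc h k] are the vertices of the path from [x] to [x + h] that changes one
    coordinate at a time. *)
Let trunc h k : 'rV[R]_n := \row_j (if (j < k)%N then h 0 j else 0).

Let truncS h (k : 'I_n) : trunc h k.+1 = trunc h k + h 0 k *: basis_vec k.
Proof.
apply/rowP => j; rewrite !mxE eqxx /= ltnS leq_eqVlt.
have [->|jk] := eqVneq j k; first by rewrite eqxx /= ltnn add0r mulr1.
by rewrite (negbTE jk : (j == k :> nat) = false) /= mulr0 addr0.
Qed.

(** The increment telescopes along the coordinate path; on each edge the mean value theorem yields a
    partial derivative at a point near [x], close to its value at [x] by continuity. *)
Lemma C1_increment f x : C1 f -> forall e : R, 0 < e ->
  \forall h \near (0 : 'rV[R]_n), `|f (x + h) - f x - \sum_i h 0 i * partial i f x|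
                     <= e * `|h|.
Proof.
move=> fC1 e e0.
(* In dimension 0 the quotient of [e] by [n] would be 0; the successor keeps the tolerance
   positive. *)
have e1 : 0 < e / n.+1%:R by rewrite divr_gt0.
have fP (i : 'I_n) : nbhs x [set z | `|partial i f x - partial i f z| <= e / n.+1%:R].
  by have [_ /(_ x) /cvgrPdist_le /(_ _ e1)] := fC1 i.
have {}fP : nbhs x [set z | forall i, `|partial i f x - partial i f z| <= e / n.+1%:R].
  exact: (@filter_forall _ _ _ _ (nbhs_filter x) fP).
have [d /= d0 dP] := (nbhs_ballP _ _).1 fP.
apply/(@nbhs_ballP R 'rV[R]_n); exists d => //= h.
rewrite -ball_normE /= sub0r normrN => hd.
have -> : f (x + h) - f x =
    \sum_(i < n) (f (x + trunc h i.+1) - f (x + trunc h i)).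
  rewrite -(big_mkord xpredT (fun k => f (x + trunc h k.+1) - f (x + trunc h k))).
  rewrite telescope_sumr//; congr (f (x + _) - f _).
    by apply/rowP => j; rewrite mxE ltn_ord.
  by apply/rowP => j; rewrite !mxE addr0.
rewrite -sumrB.
apply: le_trans (ler_norm_sum _ _ _) _.
have -> : e * `|h| = \sum_(i < n) e / n%:R * `|h|.
  rewrite sumr_const card_ord; case: (n) h {hd} => [|n'] h.
    rewrite mulr0n [h]thinmx0 normr0 mulr0 //.
  by rewrite -mulr_natr; field; rewrite addrC natr1 pnatr_eq0.
apply: ler_sum => i _; rewrite truncS addrA.
have [s s01 ->] := @MVT_along R n f (x + trunc h i) (basis_vec i) (h 0 i)
  (partial i f) (fun y => derivableP (proj1 (fC1 i) y)).
rewrite -mulrBr normrM mulrC ler_pM//; last exact: coord_le_norm.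
rewrite distrC; apply: (@le_trans _ _ (e / n.+1%:R)); last first.
  have n0 : (0 < n)%N by case: (n) i => [[]|].
  by rewrite ler_pM2l// lef_pV2 ?posrE ?ltr0n// ler_nat.
move: i s s01 => i s /andP[/ltW s0 /ltW s1]; apply: dP.
rewrite -ball_normE /= -addrA opprD addrA subrr sub0r normrN.
apply: le_lt_trans hd; apply: norm_le_coord => // j; rewrite !mxE eqxx /=.
have [jk|jk|jk] := ltngtP j i.
- by rewrite (_ : (j == i) = false) ?mulr0 ?addr0 ?coord_le_norm // -val_eqE /= ltn_eqF.
- by rewrite (_ : (j == i) = false) ?mulr0 ?addr0 ?normr0 // -val_eqE /= gtn_eqF.
- rewrite (_ : (j == i)); last by rewrite -val_eqE /= jk.
  rewrite mulr1 add0r normrM ger0_norm// (le_trans _ (coord_le_norm h i))//.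
  by rewrite ler_piMl.
Qed.

Lemma C1_differentiable f x : C1 f -> differentiable f x.
Proof.
move=> fC1.
pose A : 'cV[R]_n := \col_i partial i f x.
have @L : {linear 'rV[R]_n -> R}.
  exists (fun h : 'rV[R]_n => (h *m A) 0 0).
  do 2![eexists]; do ?[constructor].
  - by rewrite mul0mx mxE.
  - by move=> ? ?; rewrite mulmxDl mxE.
  - by move=> ? ?; rewrite -scalemxAl mxE.
have LE h : L h = \sum_i h 0 i * partial i f x.
  by rewrite /L/= mxE; apply: eq_bigr => i _; rewrite mxE.
have Lc : continuous L.
  move=> h; rewrite (funext LE); apply: cont_sum => i {}h.
  by apply: cont_mul => //; [exact: cont_coord|exact: cont_cst].
have H : f \o shift x = cst (f x) + L +o_ (0 : 'rV[R]_n) id.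
  apply/eqaddoP => e e0 /=.
  near=> h.
  rewrite (_ : (_ - _) h = f (x + h) - f x - \sum_i h 0 i * partial i f x).
    by near: h; exact: C1_increment.
  by rewrite !fctE /= -LE opprD addrA [h + x]addrC.
by apply/diff_locallyP; rewrite (diff_unique Lc H).
Unshelve. all: by end_near.
Qed.

End C1.

Section ChainRule.
Context {R : realType} {n m : nat}.
Implicit Types (f : 'rV[R]_m -> R) (g : 'rV[R]_n -> 'rV[R]_m) (x v : 'rV[R]_n).

Lemma diff_partial f (y w : 'rV[R]_m) : differentiable f y ->
  'd f y w = \sum_l w 0 l * partial l f y.
Proof.
move=> df; rewrite [w in LHS]row_sum_delta linear_sum /=; apply: eq_bigr => l _.
by rewrite linearZ /= /partial deriveE.
Qed.

(** Only the derivative of [g] along [v] is assumed. Restricted to the line through [x], [g] becomes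
    a differentiable function of one variable, to which the total differential of [f] is applied. *)
Lemma is_derive_chain f g x v (dg : 'I_m -> R) : C1 f ->
  (forall l, is_derive x v (fun y => g y 0 l) (dg l)) ->
  is_derive x v (fun y => f (g y)) (\sum_l dg l * partial l f (g x)).
Proof.
move=> fC1 dgx.
have gv : derivable g x v.
  by apply/derivable_mxP => i l; rewrite ord1; have [] := dgx l.
have /derivable1P gl := gv.
pose phi (h : R) := g (h *: v + x).
have phid : differentiable phi 0 by apply/derivable1_diffP.
have phi0 : phi 0 = g x by rewrite /phi scale0r add0r.
have fd : differentiable f (phi 0) by exact: C1_differentiable.
have fphi : differentiable (f \o phi) 0 by exact: differentiable_comp.
have x0 : x = x + 0 *: v by rewrite scale0r addr0.
rewrite [x in is_derive x]x0; apply/is_derive_along.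
rewrite (_ : (fun t => _) = f \o phi); last first.
  by apply/funext => t; rewrite /phi /= addrC.
split; first exact/derivable1_diffP.
rewrite (deriveE _ fphi) (diff_comp phid fd) /= (diff_partial _ fd) phi0.
apply: eq_bigr => l _; congr (_ * _).
have -> : 'd phi 0 1 = 'D_v g x.
  have E : (fun h : R => h^-1 *: ((phi \o shift 0) (h *: (1 : R)) - phi 0)) =
      (fun h : R => h^-1 *: ((g \o shift x) (h *: v) - g x)).
    by apply/funext => h /=; rewrite /phi /= scale0r add0r addr0 [h *: 1]mulr1.
  by rewrite -(deriveE _ phid) /derive E.
rewrite (derive_mx gv) mxE.
by have [_ <-] := dgx l.
Qed.

End ChainRule.

(** * Symmetry of mixed derivatives and the second-derivative test *)

Section Second.
Context {R : realType} {n : nat}.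
Implicit Types (f d : 'rV[R]_n -> R) (x v w : 'rV[R]_n).

Lemma is_derive_translate f x v w (a : R) :
  is_derive (x + w) v f a -> is_derive x v (fun y => f (y + w)) a.
Proof.
have E : (fun h : R => h^-1 *: ((f \o shift (x + w)) (h *: v) - f (x + w)))
  = (fun h : R => h^-1 *: (((fun y => f (y + w)) \o shift x) (h *: v)
       - f (x + w))).
  by apply/funext => h /=; rewrite addrA.
by move=> -[dv dE]; split; rewrite /derivable /derive ?E// in dv dE *;
  rewrite -?E.
Qed.

(** Schwarz's theorem: the double difference over a square of side [t] is t^2 times either mixed
    derivative at some point of the square, and both are continuous at [x]. *)
Lemma C2_partial_sym f i j x : C2 f ->
  partial i (partial j f) x = partial j (partial i f) x.
Proof.
move=> [fC1 fC2].
have d1 k y : is_derive y (basis_vec k) f (partial k f y).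
  by apply: derivableP; exact: (fC1 k).1.
have d2 k l y : is_derive y (basis_vec k) (partial l f) (partial k (partial l f) y).
  by apply: derivableP; exact: (fC2 l k).1.
(* The double difference is computed along [k] first, then along [l]. *)
have dd k l (t : R) : exists s s', [/\ 0 < s < 1, 0 < s' < 1 &
    f (x + t *: basis_vec k + t *: basis_vec l) - f (x + t *: basis_vec k)
    - (f (x + t *: basis_vec l) - f x) =
    t * (t * partial l (partial k f)
      (x + (s * t) *: basis_vec k + (s' * t) *: basis_vec l))].
  have [s s01 Es] := @MVT_along R n (fun y => f (y + t *: basis_vec l) - f y) x
    (basis_vec k) t (fun y => partial k f (y + t *: basis_vec l) - partial k f y)
    (fun y => is_deriveB (is_derive_translate (d1 k _)) (d1 k y)).
  have [s' s'01 Es'] := @MVT_along R n (partial k f) (x + (s * t) *: basis_vec k)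
    (basis_vec l) t _ (d2 l k).
  by exists s, s'; split => //; rewrite Es Es'.
apply/eqP; rewrite -subr_eq0 -normr_le0; apply/ler_addgt0Pl => e e0; rewrite addr0.
have e2 : 0 < e / 2 by rewrite divr_gt0.
have N k l : nbhs x [set z | `|partial k (partial l f) x - partial k (partial l f) z| <= e / 2].
  by have [_ /(_ x) /cvgrPdist_le /(_ _ e2)] := fC2 l k.
have [r /= r0 rP] := (@nbhs_ballP R 'rV[R]_n _ _).1 (filterI (N i j) (N j i)).
(* The intermediate points are within 2 t = r / 2 of [x], strictly inside the ball. *)
pose t := r / 4.
have t0 : 0 < t by rewrite divr_gt0.
have inball k l (s s' : R) : 0 < s < 1 -> 0 < s' < 1 ->
    ball x r (x + (s * t) *: basis_vec k + (s' * t) *: basis_vec l).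
  have nb q : `|basis_vec q : 'rV[R]_n| <= 1.
    by apply: norm_le_coord => // p; rewrite mxE eqxx /=; case: eqP; rewrite ?normr1 ?normr0.
  have sc q (a : R) : 0 < a < 1 -> `|(a * t) *: (basis_vec q : 'rV[R]_n)| <= t.
    move=> /andP[a0 a1]; rewrite normrZ normrM (gtr0_norm a0) (gtr0_norm t0).
    rewrite -[X in _ <= X]mulr1 ler_pM//; first by rewrite mulr_ge0// ltW.
    by rewrite ler_piMl ?ltW.
  move=> s01 s'01; rewrite -ball_normE /= -addrA opprD addrA subrr sub0r normrN.
  apply: (le_lt_trans (ler_normD _ _)).
  apply: (@le_lt_trans _ _ (t + t)); first by rewrite lerD// sc.
  by rewrite /t; lra.
have [s1 [s1' [h1 h1' E1]]] := dd i j t.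
have [s2 [s2' [h2 h2' E2]]] := dd j i t.
have [_ P1] := rP _ (inball i j _ _ h1 h1').
have [P2 _] := rP _ (inball j i _ _ h2 h2').
have E : partial j (partial i f) (x + (s1 * t) *: basis_vec i + (s1' * t) *: basis_vec j)
   = partial i (partial j f) (x + (s2 * t) *: basis_vec j + (s2' * t) *: basis_vec i).
  apply: (mulfI (lt0r_neq0 t0)); apply: (mulfI (lt0r_neq0 t0)).
  apply: (etrans (esym E1)); apply: etrans E2.
  rewrite [x + t *: basis_vec i + _]addrAC.
  by move: (f (_ + _ + _)) (f (x + _)) (f (x + _)) (f x) => A B C D; ring.
rewrite /= E in P1; rewrite /= in P2; rewrite [leRHS]splitr.
apply: le_trans (lerD P2 P1).
rewrite -[X in _ <= _ + X]normrN; apply: le_trans (ler_normD _ _).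
by rewrite opprB addrA subrK.
Qed.

(** If [D] were positive, the first derivative, which vanishes at the maximum, would be positive
    just after it, and the mean value theorem would make [f] exceed its maximum. *)
Lemma derive2_at_max f d x v (D r : R) : 0 < r ->
  (forall y, is_derive y v f (d y)) -> is_derive x v d D ->
  (forall t, `|t| < r -> f (x + t *: v) <= f x) -> D <= 0.
Proof.
move=> r0 fd dD fmax.
have dl (t : R) : is_derive t 1 (fun t => f (x + t *: v)) (d (x + t *: v)).
  exact/is_derive_along.
have d0 : d x = 0.
  have r0' : - r < r by rewrite gtrN.
  have i0 : (0 : R) \in `]- r, r[ by rewrite in_itv /= oppr_lt0 r0.
  have M t : t \in `]- r, r[ -> f (x + t *: v) <= f (x + 0 *: v).
    by rewrite in_itv /= -ltr_norml scale0r addr0; exact: fmax.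
  have [_ E0] := derive1_at_max (ltW r0') (fun t _ => @ex_derive _ _ _ _ _ _ _ (dl t)) i0 M.
  by have [_] := dl 0; rewrite E0 scale0r addr0.
rewrite leNgt; apply/negP => D0.
have [dv Dv] := dD.
have : \forall h \near 0^', 0 < h^-1 *: ((d \o shift x) (h *: v) - d x).
  have := dv; rewrite /derivable => /cvg_ex[l /= cl].
  have lE : l = D by rewrite -Dv /derive; apply/esym/cvg_lim.
  move: cl; rewrite lE => /cvgrPdist_lt /(_ _ D0); apply: filterS => h.
  by move=> /ltr_normlP[]; rewrite ?opprB; lra.
move=> [q /= q0 qP].
pose t := Num.min q r / 2.
have m0 : 0 < Num.min q r by rewrite lt_min q0 r0.
have t0 : 0 < t by rewrite divr_gt0.
have tm : t < Num.min q r by rewrite /t; lra.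
have [s /andP[s0 s1] E] := @MVT_along R n f x v t d fd.
have st0 : 0 < s * t by rewrite mulr_gt0.
have stt : s * t < t by rewrite gtr_pMl.
have := qP (s * t); rewrite /ball_ /= sub0r normrN gtr0_norm//.
rewrite d0 subr0 addrC.
have -> : s * t < q by rewrite (lt_trans stt)// (lt_le_trans tm)// ge_min lexx.
move=> /(_ isT (lt0r_neq0 st0)) H.
have dpos : 0 < d (x + (s * t) *: v).
  by move: H; rewrite [_ *: _]mulrC pmulr_lgt0 ?invr_gt0.
have := fmax t; rewrite gtr0_norm// => /(_ (lt_le_trans tm _)).
rewrite ge_min lexx orbT => /(_ isT).
by rewrite -subr_le0 E leNgt mulr_gt0.
Qed.

End Second.

(** * Integration of compactly supported functions *)

Section MeasurabilityRn.
Context {R : realType}.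
Local Notation Rn n := (n.-tuple (measurableTypeR R)).

Lemma measurable_box n (A : 'I_n -> set (measurableTypeR R)) :
  (forall i, measurable (A i)) ->
  measurable [set t : Rn n | forall i, A i (tnth t i)].
Proof.
move=> mA; rewrite [X in measurable X](_ : _ =
    \bigcap_(i in [set: 'I_n]) (@tnth n _ ^~ i @^-1` A i)).
  apply: fin_bigcap_measurable => [|i _]; first exact: finite_finset.
  by rewrite -[X in measurable X]setTI; exact: measurable_tnth.
by apply/seteqP; split=> t /= h i; [move=> _|]; exact: h.
Qed.

(** Boxes with rational centre and half-side 1 / (k + 1) form a countable base. They link the
    topology of row vectors to the product sigma-algebra on tuples: an open set is a countable union
    of boxes. *)
Let qbox n (qk : n.-tuple rat * nat) : set 'rV[R]_n :=
  [set x | forall i, ratr (tnth qk.1 i) - qk.2.+1%:R^-1 < x 0 i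
                     < ratr (tnth qk.1 i) + qk.2.+1%:R^-1].

Lemma open_bigcup_qbox n (U : set 'rV[R]_n) : open U ->
  U = \bigcup_(qk in [set qk | qbox qk `<=` U]) qbox qk.
Proof.
move=> oU; apply/seteqP; split => [x Ux|x [qk /= sub]]; last exact: sub.
have [r /= r0 rU] := (@nbhs_ballP R 'rV[R]_n _ _).1 (open_nbhs_nbhs (conj oU Ux)).
(* Two points of the box may differ by two half-sides in each coordinate, so 2 / (k + 1) has to stay
   below [r]. *)
pose k := Num.truncn (2 / r).
have k0 : 0 < k.+1%:R^-1 :> R by rewrite invr_gt0.
have kr : 2 * k.+1%:R^-1 < r.
  have : 2 / r < k.+1%:R by exact: truncnS_gt.
  by rewrite ltr_pdivrMr// mulrC -ltr_pdivrMr.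
have q_ex i : exists q : rat, x 0 i - k.+1%:R^-1 < ratr q < x 0 i + k.+1%:R^-1.
  have [|q] := @rat_in_itvoo R (x 0 i - k.+1%:R^-1) (x 0 i + k.+1%:R^-1).
    by rewrite ltrD2l gtrN.
  by rewrite in_itv; exists q.
pose q := [tuple projT1 (cid (q_ex i)) | i < n].
have qP i : x 0 i - k.+1%:R^-1 < ratr (tnth q i) < x 0 i + k.+1%:R^-1.
  by rewrite tnth_mktuple; case: (cid (q_ex i)).
exists (q, k); rewrite /qbox /=; move: (k.+1%:R^-1) k0 kr qP => e k0 kr qP; last first.
  by move=> i /=; have /andP[? ?] := qP i; apply/andP; split; lra.
move=> y /= yq; apply: rU; rewrite -ball_normE /=.
apply: norm_lt_coord => // i; rewrite !mxE.
have /= /andP[? ?] := yq i; have /andP[? ?] := qP i.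
by rewrite ltr_norml; apply/andP; split; lra.
Qed.

Lemma measurable_open_Rn n (U : set 'rV[R]_n) : open U ->
  measurable (@row_of_tuple R n @^-1` U).
Proof.
move=> /open_bigcup_qbox ->; rewrite bigcup_mkcond preimage_bigcup.
apply: countable_bigcupT_measurable => [|qk]; first exact: countableP.
case: ifPn => _; last by rewrite preimage_set0.
pose B i : set (measurableTypeR R) := `](ratr (tnth qk.1 i) - qk.2.+1%:R^-1),
  (ratr (tnth qk.1 i) + qk.2.+1%:R^-1)[%classic.
rewrite (_ : _ @^-1` _ = [set t : Rn n | forall i, B i (tnth t i)]).
  by apply: measurable_box => i; exact: measurable_itv.
by apply/seteqP; split => t /= H i; have := H i; rewrite /B /= mxE in_itv.
Qed.

Lemma measurable_continuous_Rn n (f : 'rV[R]_n -> R) : continuous f ->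
  measurable_fun setT (fun t : Rn n => f (row_of_tuple t)).
Proof.
move=> cf; apply: (measurability _ (RGenOpens.measurableE R)).
move=> _ [_ [a [b ->] <-]]; rewrite setTI.
have oab : open `]a, b[%classic by exact: interval_open.
exact: measurable_open_Rn (open_comp (fun x _ => cf x) oab).
Qed.

End MeasurabilityRn.

Section CompactSupport.
Context {R : realType}.
Local Notation Rn n := (n.-tuple (measurableTypeR R)).

(** Vanishing outside a ball of the sup norm; sums, products and derivatives inherit this form with
    an explicit radius. *)
Definition compact_supp n (f : 'rV[R]_n -> R) :=
  exists r : R, forall x, r <= `|x| -> f x = 0.

Lemma compact_supp_bounded n (f : 'rV[R]_n -> R) : continuous f ->
  compact_supp f -> exists M : R, forall x, `|f x| <= M.
Proof.
move=> cf [r fr].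
have r0 : 0 <= Num.max 0 r by rewrite le_max lexx.
have cA : compact [set x : 'rV[R]_n | `|x| <= Num.max 0 r].
  apply: bounded_closed_compact.
    by exists (Num.max 0 r); split => [|M rM x /= xr]; rewrite ?num_real// (le_trans xr (ltW rM)).
  have : closed [set x : R | x <= Num.max 0 r] by exact: closed_le.
  move=> cl; apply: (@closed_comp _ _ (fun x : 'rV[R]_n => `|x|) _ _ cl) => x _.
  exact: norm_continuous.
have [||c _ cP] := @EVT_max_rV R n (fun x => `|f x|) _ _ cA.
- by exists 0 => /=; rewrite normr0.
- apply: continuous_subspaceT => x; apply: continuous_comp (cf x) _.
  exact: norm_continuous.
exists `|f c| => x; have [xr|xr] := leP `|x| (Num.max 0 r).
  by apply: cP; rewrite inE.
by rewrite fr ?normr0// (le_trans _ (ltW xr))// le_max lexx orbT.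
Qed.

Definition cubeRn n (r : R) : set (Rn n) :=
  [set t | forall i, `[(- r), r]%classic (tnth t i)].

Lemma measurable_cubeRn n r : measurable (@cubeRn n r).
Proof.
apply: (@measurable_box R n (fun=> `[(- r), r]%classic)) => i.
exact: measurable_itv.
Qed.

Lemma cubeRn_lty n r : (@lebesgue_Rn R n (@cubeRn n r) < +oo)%E.
Proof.
rewrite /cubeRn (@lebesgue_Rn_box R n (fun=> `[(- r)%R, r]%classic)); last by move=> i; exact: measurable_itv.
have [k ->] : exists k : R, (\prod_(i < n) lebesgue_measure `[(- r)%R, r] = k%:E)%E.
  apply: (big_ind (fun x : \bar R => exists k : R, x = k%:E)).
  - by exists 1.
  - by move=> _ _ [k ->] [l ->]; exists (k * l); rewrite EFinM.
  - by move=> i _; rewrite lebesgue_measure_itv; case: ifP => _; [exists (r - - r)|exists 0].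
exact: ltry.
Qed.

Lemma integrable_Rn n (f : 'rV[R]_n -> R) : continuous f -> compact_supp f ->
  (@lebesgue_Rn R n).-integrable setT (fun t => (f (row_of_tuple t))%:E).
Proof.
move=> cf sf; have [M fM] := compact_supp_bounded cf sf.
have [r fr] := sf.
have -> : (fun t : Rn n => (f (row_of_tuple t))%:E) =
    (EFin \o (fun t : Rn n => f (row_of_tuple t))) \_ (@cubeRn n r).
  apply/funext => t; rewrite patchE; case: ifPn => // /negP tr.
  rewrite /= fr// leNgt; apply/negP => tlt; apply: tr; rewrite inE => i /=.
  rewrite in_itv /= -ler_norml; apply: le_trans (ltW tlt).
  by have := coord_le_norm (row_of_tuple t) i; rewrite mxE.
apply: (iffLR (integrable_mkcond _ (@measurable_cubeRn n r))).
apply: measurable_bounded_integrable.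
- exact: measurable_cubeRn.
- exact: cubeRn_lty.
- by apply: measurable_funTS; exact: measurable_continuous_Rn.
- exists M; split; first exact: num_real.
  by move=> x Mx t _ /=; exact: le_trans (fM _) (ltW Mx).
Qed.

(** The measure on R^(n + 1) is a pushforward of a product measure; undoing the pushforward makes
    Fubini's theorem available. *)
Lemma integral_cons n (f : 'rV[R]_n.+1 -> R) : continuous f -> compact_supp f ->
  (lebesgue_measure \x @lebesgue_Rn R n)%E.-integrable setT
     (fun p => (f (row_of_tuple (cons_pair p)))%:E) /\
  (\int[@lebesgue_Rn R n.+1]_t (f (row_of_tuple t))%:E =
   \int[lebesgue_measure \x @lebesgue_Rn R n]_p (f (row_of_tuple (cons_pair p)))%:E)%E.
Proof.
move=> cf sf.
have mf : measurable_fun [set: Rn n.+1] (EFin \o (fun t : Rn n.+1 => f (row_of_tuple t))).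
  by apply/measurable_EFinP; exact: measurable_continuous_Rn.
have mcf : measurable_fun [set: measurableTypeR R * Rn n]
    (EFin \o (fun p : measurableTypeR R * Rn n => f (row_of_tuple (cons_pair p)))).
  exact: (measurableT_comp mf (@measurable_cons_pair R n)).
have int : (lebesgue_measure \x @lebesgue_Rn R n)%E.-integrable setT
     (fun p => (f (row_of_tuple (cons_pair p)))%:E).
  apply/integrableP; split => //.
  have /integrableP[_] := integrable_Rn cf sf.
  rewrite (@ge0_integral_pushforward _ _ _ _ _ _ (@measurable_cons_pair R n)
    (lebesgue_measure \x @lebesgue_Rn R n)%E setT (fun t => `|(f (row_of_tuple t))%:E|%E))//.
  exact: measurableT_comp.
split => //.
exact: (@integral_pushforward _ _ _ _ _ _ (@measurable_cons_pair R n)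
    (lebesgue_measure \x @lebesgue_Rn R n)%E setT (fun t => (f (row_of_tuple t))%:E)).
Qed.

End CompactSupport.

(** * Integrals of derivatives of compactly supported functions *)

Section IntegrationByParts.
Context {R : realType}.
Local Notation Rn n := (n.-tuple (measurableTypeR R)).

(** The fundamental theorem on an interval outside which [dg] vanishes and at whose ends [g]
    vanishes. *)
Lemma integral_derive0 (g dg : R -> R) (r : R) :
  (forall x : R, is_derive x (1 : R) g (dg x)) -> continuous dg ->
  (forall x, r <= `|x| -> g x = 0) ->
  (\int[lebesgue_measure]_x (dg x)%:E = 0)%E.
Proof.
move=> gd cdg g0.
pose b := `|r| + 1.
have b0 : 0 < b by rewrite /b; have := normr_ge0 r; lra.
have rb : r < b by rewrite /b; have := ler_norm r; lra.
have dg0 x : r < `|x| -> dg x = 0.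
  move=> rx; have [_ <-] := gd x.
  have : {near x, g =1 cst 0}.
    have /nbhs_ballP[e /= e0 eP] : nbhs x [set y : R | r < `|y|].
      apply: open_nbhs_nbhs; split => //=.
      apply: (@open_comp _ _ (fun y : R => `|y|) [set z | r < z]); last exact: open_gt.
      by move=> y _; exact: norm_continuous.
    by apply/nbhs_ballP; exists e => //= y /eP /= /ltW /g0.
  by move=> /near_eq_derive ->; rewrite ?oner_neq0// derive_cst.
rewrite (_ : (fun x => (dg x)%:E) = (EFin \o dg) \_ `[(- b), b]); last first.
  apply/funext => x; rewrite patchE; case: ifPn => // /negP xb.
  rewrite /= dg0// ltNge; apply/negP => xr; apply: xb.
  by rewrite inE /= in_itv /= -ler_norml (le_trans xr)// ltW.
rewrite -integral_mkcond.
have gc x : {for x, continuous g}.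
  by apply: differentiable_continuous; apply/derivable1_diffP; have [] := gd x.
have nb : - b < b by rewrite gtrN.
rewrite (@continuous_FTC2 R dg g (- b) b)//.
- by rewrite !g0 ?subee// ?normrN gtr0_norm// ltW.
- exact: continuous_subspaceT.
- split => [x _| |].
  + by have [] := gd x.
  + exact/cvg_at_right_filter/gc.
  + exact/cvg_at_left_filter/gc.
- by move=> x _; rewrite derive1E; have [] := gd x.
Qed.

Let row_cons n (x : R) (y : 'rV[R]_n) : 'rV[R]_n.+1 :=
  \row_i oapp (fun j => y 0 j) x (unlift ord0 i).

Let row_cons0 n x (y : 'rV[R]_n) : row_cons x y 0 ord0 = x.
Proof. by rewrite mxE unlift_none. Qed.

Let row_consS n x (y : 'rV[R]_n) j : row_cons x y 0 (lift ord0 j) = y 0 j.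
Proof. by rewrite mxE liftK. Qed.

Let row_of_cons n (p : measurableTypeR R * Rn n) :
  row_of_tuple (cons_pair p) = row_cons p.1 (row_of_tuple p.2).
Proof.
apply/rowP => i; rewrite mxE; case: (unliftP ord0 i) => [j ->|->].
  by rewrite tnthS row_consS mxE.
by rewrite tnth0 row_cons0.
Qed.

Let row_cons_head n x (y : 'rV[R]_n) :
  row_cons x y = row_cons 0 y + x *: basis_vec ord0.
Proof.
apply/rowP => i; rewrite !mxE eqxx /=; case: (unliftP ord0 i) => [j ->|->].
  by rewrite /= mulr0 addr0.
by rewrite /= mulr1 add0r.
Qed.

Let row_cons_tail n x (y : 'rV[R]_n) j (h : R) :
  row_cons x (h *: basis_vec j + y) = h *: basis_vec (lift ord0 j) + row_cons x y.
Proof.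
apply/rowP => i; rewrite !mxE eqxx /=; case: (unliftP ord0 i) => [k ->|->].
  by rewrite /= !mxE (inj_eq lift_inj) eqxx.
by rewrite /= mulr0 add0r.
Qed.

Let row_cons_continuous n x : continuous (@row_cons n x).
Proof.
move=> y; have FF := nbhs_filter y; apply/(cvgrPdist_lt (FF := FF)) => e e0.
apply/(@nbhs_ballP R 'rV[R]_n); exists e => // z; rewrite -ball_normE /= => yz.
apply: norm_lt_coord => // i; case: (unliftP ord0 i) => [k ->|->].
  rewrite !mxE liftK /=; apply: le_lt_trans yz.
  by have := coord_le_norm (y - z) k; rewrite !mxE.
by rewrite !mxE unlift_none /= subrr normr0.
Qed.

Let norm_row_cons0 n x (y : 'rV[R]_n) : `|x| <= `|row_cons x y|.
Proof. by have := coord_le_norm (row_cons x y) ord0; rewrite row_cons0. Qed.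

Let norm_row_consS n x (y : 'rV[R]_n) : `|y| <= `|row_cons x y|.
Proof.
apply: norm_le_coord => // i.
by have := coord_le_norm (row_cons x y) (lift ord0 i); rewrite row_consS.
Qed.

Lemma compact_supp_derive n (F dF : 'rV[R]_n -> R) v :
  (forall x, is_derive x v F (dF x)) -> compact_supp F -> compact_supp dF.
Proof.
(* The margin 1 leaves a whole ball around [x] on which [F] vanishes. *)
move=> Fd [r Fr]; exists (r + 1) => x xr; have [_ <-] := Fd x.
have [->|v0] := eqVneq v 0; first exact: derive0.
have : {near x, F =1 cst 0}.
  apply/(@nbhs_ballP R 'rV[R]_n); exists 1 => //= y.
  rewrite -ball_normE /= => xy; apply: Fr.
  have := ler_normD (x - y) y; rewrite subrK; lra.
by move=> /near_eq_derive ->//; exact: derive_cst.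
Qed.

(** Fubini in the order that puts variable [i] inside: for the first coordinate the inner integral
    is one-dimensional, otherwise the first coordinate is frozen and the induction hypothesis
    applies to the slice. *)
Lemma integral_partial0 n (F dF : 'rV[R]_n -> R) i :
  (forall x, is_derive x (basis_vec i) F (dF x)) -> continuous dF ->
  compact_supp F ->
  (\int[@lebesgue_Rn R n]_t (dF (row_of_tuple t))%:E = 0)%E.
Proof.
elim: n F dF i => [F dF []//|n IH] F dF i Fd cdF sF.
have sdF := compact_supp_derive Fd sF.
have [int ->] := integral_cons cdF sdF.
have [r Fr] := sF.
case: (unliftP ord0 i) Fd => [j ->|->] Fd.
  rewrite -(integral12_prod_meas1 int); apply: integral0_eq => x _.
  rewrite /fubini_F.
  under eq_integral do rewrite row_of_cons /=.
  apply: (IH (fun y => F (row_cons x y)) (fun y => dF (row_cons x y)) j).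
  - move=> y.
    have E : (fun h : R => h^-1 *: (((fun y => F (row_cons x y)) \o shift y)
          (h *: basis_vec j) - F (row_cons x y))) =
        (fun h : R => h^-1 *: ((F \o shift (row_cons x y))
          (h *: basis_vec (lift ord0 j)) - F (row_cons x y))).
      by apply/funext => h /=; rewrite row_cons_tail.
    by have [dv dE] := Fd (row_cons x y); split; rewrite /derivable /derive E.
  - by move=> y; apply: continuous_comp; [exact: row_cons_continuous|exact: cdF].
  - by exists r => y yr; apply: Fr; exact: le_trans yr (norm_row_consS _ _).
rewrite -(integral21_prod_meas1 int); apply: integral0_eq => t _.
rewrite /fubini_G.
under eq_integral do rewrite row_of_cons /= row_cons_head.
apply: (@integral_derive0 (fun x => F (row_cons 0 (row_of_tuple t) + x *: basis_vec ord0))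
  _ r).
- by move=> x; apply/is_derive_along.
- move=> x; apply: continuous_comp; last exact: cdF.
  by apply: cvgD; [exact: cvg_cst|apply: cvgZr_tmp; exact: cvg_id].
- by move=> x rx; rewrite -row_cons_head; apply: Fr; exact: le_trans rx (norm_row_cons0 _ _).
Qed.

End IntegrationByParts.

(** * Real-valued integrals of test functions *)

Section IntegralRn.
Context {R : realType} {n : nat}.
Implicit Types (f g : 'rV[R]_n -> R).
Local Notation Rn n := (n.-tuple (measurableTypeR R)).

(** The domain of integration is carried by the weights, so the integral runs over the whole space;
    its real value is faithful for test functions, which are integrable. *)
Definition Rintegral_Rn f : R :=
  (\int[@lebesgue_Rn R n]_t f (row_of_tuple t))%R.

Definition test_fun f := continuous f /\ compact_supp f.

Lemma test_fun_integrable f : test_fun f ->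
  (@lebesgue_Rn R n).-integrable setT
    (EFin \o (fun t : Rn n => f (row_of_tuple t))).
Proof. by move=> [cf sf]; exact: integrable_Rn. Qed.

Lemma test_fun_mul f g : test_fun f -> continuous g ->
  test_fun (fun x => f x * g x).
Proof.
move=> [cf [r fr]] cg; split; first exact: cont_mul.
by exists r => x /fr ->; rewrite mul0r.
Qed.

Lemma test_fun_add f g : test_fun f -> test_fun g -> test_fun (fun x => f x + g x).
Proof.
move=> [cf [r fr]] [cg [s gs]]; split; first exact: cont_add.
by exists (Num.max r s) => x; rewrite ge_max => /andP[/fr -> /gs ->]; rewrite addr0.
Qed.

Lemma test_fun_scale (c : R) f : test_fun f -> test_fun (fun x => c * f x).
Proof.
move=> [cf [r fr]]; split; first by apply: cont_mul => //; exact: cont_cst.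
by exists r => x /fr ->; rewrite mulr0.
Qed.

Lemma test_fun_sum (I : Type) (s : seq I) (F : I -> 'rV[R]_n -> R) :
  (forall i, test_fun (F i)) -> test_fun (fun x => \sum_(i <- s) F i x).
Proof.
move=> tF; elim: s => [|i s IH].
  under eq_fun do rewrite big_nil.
  by split; [exact: cont_cst|exists 0].
by under eq_fun do rewrite big_cons; exact: test_fun_add.
Qed.

Lemma Rintegral_Rn_add f g : test_fun f -> test_fun g ->
  Rintegral_Rn (fun x => f x + g x) = Rintegral_Rn f + Rintegral_Rn g.
Proof. by move=> /test_fun_integrable tf /test_fun_integrable tg; exact: RintegralD. Qed.

Lemma Rintegral_Rn_scale (c : R) f : test_fun f ->
  Rintegral_Rn (fun x => c * f x) = c * Rintegral_Rn f.
Proof. by move=> /test_fun_integrable tf; exact: RintegralZl. Qed.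

Lemma Rintegral_Rn_le f g : test_fun f -> test_fun g ->
  (forall x, f x <= g x) -> Rintegral_Rn f <= Rintegral_Rn g.
Proof.
move=> /test_fun_integrable tf /test_fun_integrable tg fg.
by apply: le_Rintegral => // t _; exact: fg.
Qed.

Lemma Rintegral_Rn_sum (I : Type) (s : seq I) (F : I -> 'rV[R]_n -> R) :
  (forall i, test_fun (F i)) ->
  Rintegral_Rn (fun x => \sum_(i <- s) F i x) = \sum_(i <- s) Rintegral_Rn (F i).
Proof.
move=> tF; elim: s => [|i s IH].
  rewrite big_nil; under eq_fun do rewrite big_nil.
  by rewrite /Rintegral_Rn Rintegral_cst// mul0r.
rewrite big_cons -IH -Rintegral_Rn_add//; last exact: test_fun_sum.
by congr Rintegral_Rn; apply/funext => x; rewrite big_cons.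
Qed.

Lemma Rintegral_Rn_partial (F dF : 'rV[R]_n -> R) i :
  (forall x, is_derive x (basis_vec i) F (dF x)) -> continuous dF ->
  compact_supp F -> Rintegral_Rn dF = 0.
Proof.
by move=> Fd cdF sF; rewrite /Rintegral_Rn /Rintegral (integral_partial0 Fd).
Qed.

Lemma test_fun_partial (F dF : 'rV[R]_n -> R) i :
  (forall x, is_derive x (basis_vec i) F (dF x)) -> continuous dF ->
  compact_supp F -> test_fun dF.
Proof. by move=> Fd cdF sF; split => //; exact: compact_supp_derive Fd sF. Qed.

(** By continuity [f] exceeds [f x / 2] on a small cube around [x], whose measure is positive by the
    product formula for boxes. *)
Lemma Rintegral_Rn_gt0 f x : test_fun f -> (forall y, 0 <= f y) -> 0 < f x ->
  0 < Rintegral_Rn f.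
Proof.
move=> tf f0 fx; have intf := test_fun_integrable tf.
have N : nbhs x [set y | f x / 2 < f y].
  apply: (open_nbhs_nbhs (conj _ _)); last by rewrite /=; lra.
  apply: (@open_comp _ _ f [set z | f x / 2 < z]); last exact: open_gt.
  by move=> y _; exact: tf.1.
have [d /= d0 dP] := (@nbhs_ballP R 'rV[R]_n _ _).1 N.
pose B i : set (measurableTypeR R) := `[(x 0 i - d / 2), (x 0 i + d / 2)]%classic.
pose C := [set t : Rn n | forall i, B i (tnth t i)].
have mC : measurable C by apply: measurable_box => i; exact: measurable_itv.
have C0 : (0 < @lebesgue_Rn R n C)%E.
  rewrite /C lebesgue_Rn_box; last by move=> i; exact: measurable_itv.
  apply: (big_ind (fun z : \bar R => 0 < z)%E) => [|y z|i _]; first exact: lte01.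
    exact: mule_gt0.
  rewrite lebesgue_measure_itv /= lte_fin ifT; last by lra.
  by rewrite -EFinD lte_fin; lra.
apply: fine_gt0; apply/andP; split; last first.
  by rewrite ltey_eq integrable_fin_num.
apply: (@lt_le_trans _ _ (\int[@lebesgue_Rn R n]_(t in C) (f x / 2)%:E)%E).
  rewrite integral_cst//; apply: mule_gt0 => //.
  by rewrite lte_fin divr_gt0.
apply: (@le_trans _ _ (\int[@lebesgue_Rn R n]_(t in C) (f (row_of_tuple t))%:E)%E).
  apply: ge0_le_integral => //.
  - by move=> t _; rewrite lee_fin divr_ge0// ltW.
  - by apply: measurable_funTS; have /integrableP[] := intf.
  - move=> t Ct; rewrite lee_fin ltW//; apply: dP; rewrite -ball_normE /=.
    apply: norm_lt_coord => // i; rewrite !mxE.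
    have := Ct i; rewrite /B /= in_itv /= => /andP[? ?].
    by rewrite ltr_norml; apply/andP; split; lra.
apply: ge0_subset_integral => //.
- by have /integrableP[] := intf.
- by move=> t _; rewrite lee_fin.
Qed.

End IntegralRn.

Lemma cont_comp {R : realType} {T U : topologicalType} (f : U -> R) (g : T -> U) :
  continuous f -> continuous g -> continuous (fun x => f (g x)).
Proof. by move=> cf cg x; apply: continuous_comp; [exact: cg|exact: cf]. Qed.

Lemma cont_reflection {R : realType} {n : nat} (x0 w : 'rV[R]_n) (h : 'rV[R]_n -> R) :
  continuous h -> continuous (fun y : 'rV[R]_n => x0 + y - h y *: w).
Proof.
move=> ch y; have FF := nbhs_filter y.
apply: (@cvgB R 'rV[R]_n 'rV[R]_n (nbhs y) FF (fun y => x0 + y) (fun y => h y *: w)).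
  by apply: (@cvgD R 'rV[R]_n 'rV[R]_n (nbhs y) FF (fun=> x0) id);
    [exact: cvg_cst|exact: cvg_id].
by apply: (@cvgZr_tmp R 'rV[R]_n 'rV[R]_n (nbhs y) FF h); exact: ch.
Qed.

Lemma cont_translation {R : realType} {n : nat} (x0 : 'rV[R]_n) :
  continuous (fun y : 'rV[R]_n => y + x0).
Proof.
move=> y; have FF := nbhs_filter y.
by apply: (@cvgD R 'rV[R]_n 'rV[R]_n (nbhs y) FF id (fun=> x0));
  [exact: cvg_id|exact: cvg_cst].
Qed.

(** * Interior gradient bound *)

Section PointwiseDerivation.
Context {R : realType} {V : normedModType R}.
Implicit Types (f g : V -> R) (x v : V).

Lemma deriv_cst (c : R) x v : is_derive x v (fun _ => c) 0.
Proof. exact: is_derive_cst. Qed.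

Lemma deriv_add f g x v (df dg : R) : is_derive x v f df ->
  is_derive x v g dg -> is_derive x v (fun y => f y + g y) (df + dg).
Proof. exact: is_deriveD. Qed.

Lemma deriv_sub f g x v (df dg : R) : is_derive x v f df ->
  is_derive x v g dg -> is_derive x v (fun y => f y - g y) (df - dg).
Proof. exact: is_deriveB. Qed.

Lemma deriv_mul f g x v (df dg : R) : is_derive x v f df ->
  is_derive x v g dg -> is_derive x v (fun y => f y * g y) (df * g x + f x * dg).
Proof.
move=> Hf Hg; apply: (is_derive_eq (is_deriveM Hf Hg)).
by rewrite /GRing.scale /= addrC [g x * _]mulrC.
Qed.

Lemma deriv_scale (c : R) f x v (df : R) :
  is_derive x v f df -> is_derive x v (fun y => c * f y) (c * df).
Proof.
move=> Hf; apply: (is_derive_eq (deriv_mul (deriv_cst c x v) Hf)).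
by rewrite mul0r add0r.
Qed.

Lemma deriv_sqr f x v (df : R) :
  is_derive x v f df -> is_derive x v (fun y => f y ^+ 2) (2 * (f x * df)).
Proof.
move=> Hf; apply: (is_derive_eq (deriv_mul Hf Hf)).
by rewrite [df * _]mulrC -mulr2n mulr_natl.
Qed.

Lemma deriv_sum n (F : 'I_n -> V -> R) x v (dF : 'I_n -> R) :
  (forall i, is_derive x v (F i) (dF i)) ->
  is_derive x v (fun y => \sum_i F i y) (\sum_i dF i).
Proof.
move=> HF; rewrite (_ : (fun _ => _) = \sum_i F i); last first.
  by apply/funext => y; rewrite fct_sumE.
exact: is_derive_sum.
Qed.

End PointwiseDerivation.

Section Coordinates.
Context {R : realType} {n : nat}.

Lemma deriv_coord (l : 'I_n) (x v : 'rV[R]_n) :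
  is_derive x v (fun y : 'rV[R]_n => y 0 l) (v 0 l).
Proof.
have E : (fun h : R => h^-1 *: (((fun y : 'rV[R]_n => y 0 l) \o shift x) (h *: v) - x 0 l))
    @ 0^' --> v 0 l.
  apply: cvg_near_cst; exists 1 => //= h _ h0.
  by rewrite !mxE addrK [_ *: _]mulKf.
split; first by apply/cvg_ex; exists (v 0 l).
exact: cvg_lim.
Qed.

Lemma basis_vecE (i l : 'I_n) : basis_vec i 0 l = (l == i)%:R :> R.
Proof. by rewrite mxE eqxx. Qed.

End Coordinates.

(** * Reflection and barrier on a half cube *)

Section GradientBound.
Context {R : realType} {n : nat}.
Implicit Types (f : 'rV[R]_n -> R) (x y : 'rV[R]_n).

Let refl (j : 'I_n) x0 y : 'rV[R]_n := x0 + y - (2 * y 0 j) *: basis_vec j.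

Let sg (j i : 'I_n) : R := 1 - 2 * (j == i)%:R.

Let deriv_refl f j x0 i y : C1 f ->
  is_derive y (basis_vec i) (fun y => f (refl j x0 y))
    (sg j i * partial i f (refl j x0 y)).
Proof.
move=> fC1.
have D l : is_derive y (basis_vec i) (fun y => refl j x0 y 0 l)
    ((l == i)%:R - 2 * (l == j)%:R * (j == i)%:R).
  rewrite (_ : (fun _ => _) = fun y : 'rV[R]_n =>
      x0 0 l + y 0 l - 2 * (l == j)%:R * y 0 j); last first.
    by apply/funext => z; rewrite !mxE eqxx /= mulrAC.
  apply: (is_derive_eq (deriv_sub (deriv_add (deriv_cst _ _ _) (deriv_coord _ _ _))
    (deriv_scale _ (deriv_coord _ _ _)))).
  by rewrite !basis_vecE add0r.
apply: (is_derive_eq (is_derive_chain fC1 D)).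
rewrite (bigD1 i)//= big1 ?addr0 => [|l li]; last first.
  rewrite (negbTE li); have [ji|ji] := eqVneq j i; last by rewrite mulr0 subr0 mul0r.
  by rewrite ji (negbTE li) mulr0 mul0r subrr mul0r.
by rewrite /sg eqxx [i == j]eq_sym; case: (j == i); rewrite !(mulr1, mulr0).
Qed.

(* [x0 + y] and its mirror image [refl j x0 y] are compared on a half cube
   through the barrier [psi], whose Laplacian is the constant [- B]. *)
Let psi (j : 'I_n) (M B : R) y : R :=
  M * (\sum_i y 0 i ^+ 2 + n%:R * (y 0 j - y 0 j ^+ 2)) +
  B / 2 * (y 0 j - y 0 j ^+ 2).

Let dpsi (j : 'I_n) (M B : R) i y : R :=
  M * (2 * y 0 i + n%:R * (j == i)%:R * (1 - 2 * y 0 j)) +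
  B / 2 * (j == i)%:R * (1 - 2 * y 0 j).

Let ddpsi (j : 'I_n) (M B : R) (i : 'I_n) : R :=
  M * (2 - 2 * n%:R * (j == i)%:R) - B * (j == i)%:R.

Let deriv_bump j i y : is_derive y (basis_vec i) (fun y : 'rV[R]_n => y 0 j - y 0 j ^+ 2)
  ((j == i)%:R * (1 - 2 * y 0 j)).
Proof.
apply: (is_derive_eq (deriv_sub (deriv_coord _ _ _) (deriv_sqr (deriv_coord _ _ _)))).
by rewrite basis_vecE; ring.
Qed.

Let deriv_psi j M B i y :
  is_derive y (basis_vec i) (psi j M B) (dpsi j M B i y).
Proof.
have S := deriv_sum (fun k => deriv_sqr (deriv_coord k y (basis_vec i))).
apply: (is_derive_eq (deriv_add (deriv_scale _ (deriv_add S
  (deriv_scale _ (deriv_bump _ _ _)))) (deriv_scale _ (deriv_bump _ _ _)))).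
rewrite (bigD1 i)//= big1 ?addr0 => [|l li]; last first.
  by rewrite basis_vecE (negbTE li) !mulr0.
by rewrite /dpsi basis_vecE eqxx mulr1n; ring.
Qed.

Let deriv_dpsi j M B i y :
  is_derive y (basis_vec i) (dpsi j M B i) (ddpsi j M B i).
Proof.
have D : is_derive y (basis_vec i) (fun y : 'rV[R]_n => 1 - 2 * y 0 j)
    (- (2 * (j == i)%:R)).
  apply: (is_derive_eq (deriv_sub (deriv_cst _ _ _)
    (deriv_scale _ (deriv_coord _ _ _)))).
  by rewrite basis_vecE sub0r.
apply: (is_derive_eq (deriv_add (deriv_scale _ (deriv_add
  (deriv_scale _ (deriv_coord _ _ _)) (deriv_scale _ D))) (deriv_scale _ D))).
by rewrite basis_vecE eqxx /ddpsi mulr1n; case: (j == i); rewrite ?mulr1n ?mulr0n; field.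
Qed.

Let sum_ddpsi j M B : \sum_i ddpsi j M B i = - B.
Proof.
rewrite /ddpsi sumrB -!mulr_sumr sumrB sumr_const card_ord -mulr_sumr.
rewrite (bigD1 j)//= eqxx big1 => [|i ij]; last by rewrite eq_sym (negbTE ij).
by rewrite -mulr_natr mulr1n; ring.
Qed.

Let halfcube j : set 'rV[R]_n :=
  [set y | (forall i, y 0 i \in `[(-1), 1]) /\ 0 <= y 0 j].

Let halfcube_compact j : compact (halfcube j).
Proof.
apply: bounded_closed_compact.
  exists 1; split; first exact: num_real.
  move=> M M1 y [yi _] /=; apply: (le_trans _ (ltW M1)).
  by apply: norm_le_coord => // i; have := yi i; rewrite in_itv /= ler_norml.
rewrite (_ : halfcube j = (\bigcap_(i in [set: 'I_n])
    [set y : 'rV[R]_n | (y 0 i \in `[(-1), 1])]) `&` [set y : 'rV[R]_n | 0 <= y 0 j]).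
  apply: closedI.
    apply: closed_bigI => i _.
    apply: (@closed_comp _ _ (fun y : 'rV[R]_n => y 0 i) `[(-1), 1]%classic).
      by move=> y _; exact: cont_coord.
    exact: interval_closed.
  apply: (@closed_comp _ _ (fun y : 'rV[R]_n => y 0 j) [set z | 0 <= z]).
    by move=> y _; exact: cont_coord.
  exact: closed_ge.
by apply/seteqP; split => y /= [yi yj]; split => // i; [move=> _|]; exact: yi.
Qed.

(** Maximum principle: the difference of the two sides has positive Laplacian, hence no interior
    maximum. On a face where some coordinate has absolute value 1, the quadratic part of the barrier
    is at least [M], which dominates the left side; on the face [y 0 j = 0] the two values of [f]
    coincide and the barrier is nonnegative. *)
Lemma odd_barrier f (M K : R) j x0 : C2 f -> (forall y, `|f y| <= M) ->
  (forall y, `|laplacian f y| <= K) ->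
  forall y, halfcube j y -> (f (x0 + y) - f (refl j x0 y)) / 2 <= psi j M (K + 1) y.
Proof.
move=> [fC1 fC2] fM fK.
have d1 k y : is_derive y (basis_vec k) f (partial k f y).
  by apply: derivableP; exact: (fC1 k).1.
have d2 k l y : is_derive y (basis_vec k) (partial l f) (partial k (partial l f) y).
  by apply: derivableP; exact: (fC2 l k).1.
have cf : continuous f by move=> y; exact: differentiable_continuous (C1_differentiable y fC1).
pose g y := 2^-1 * (f (y + x0) - f (refl j x0 y)) - psi j M (K + 1) y.
pose dg i y := 2^-1 * (partial i f (y + x0) - sg j i * partial i f (refl j x0 y))
  - dpsi j M (K + 1) i y.
pose ddg i y := 2^-1 * (partial i (partial i f) (y + x0) -
  partial i (partial i f) (refl j x0 y)) - ddpsi j M (K + 1) i.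
have sg2 i : sg j i * sg j i = 1 by rewrite /sg; case: (j == i) => /=; ring.
have Hg i y : is_derive y (basis_vec i) g (dg i y).
  exact: (deriv_sub (deriv_scale _ (deriv_sub (is_derive_translate (d1 _ _))
    (deriv_refl _ _ _ _ fC1))) (deriv_psi _ _ _ _ _)).
have Hdg i y : is_derive y (basis_vec i) (dg i) (ddg i y).
  apply: (is_derive_eq (deriv_sub (deriv_scale _ (deriv_sub
    (is_derive_translate (d2 _ _ _)) (deriv_scale _ (deriv_refl _ _ _ _ (fC2 i)))))
    (deriv_dpsi _ _ _ _ _))).
  by rewrite mulrA sg2 mul1r.
(* Half the difference of two Laplacians is at least - K; the extra 1 in [K + 1] makes the
   inequality strict. *)
have lapg y : 0 < \sum_i ddg i y.
  have -> : \sum_i ddg i y = 2^-1 * (laplacian f (y + x0) - laplacian f (refl j x0 y))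
      + (K + 1).
    by rewrite /ddg sumrB sum_ddpsi opprK -mulr_sumr sumrB.
  move: (laplacian f (y + x0)) (laplacian f _) (fK (y + x0)) (fK (refl j x0 y)) => a b.
  by rewrite !ler_norml => /andP[? ?] /andP[? ?]; lra.
have cg : continuous g.
  have cc (i : 'I_n) : continuous (fun y : 'rV[R]_n => y 0 i) by exact: cont_coord.
  have cb : continuous (fun y : 'rV[R]_n => y 0 j - y 0 j ^+ 2).
    by apply: cont_sub; [exact: cc|exact: cont_exp].
  apply: cont_sub.
    apply: cont_mul; first exact: cont_cst.
    apply: cont_sub; apply: cont_comp => //; first exact: cont_translation.
    by apply: cont_reflection; apply: cont_mul; [exact: cont_cst|exact: cc].
  apply: cont_add; last by apply: cont_mul => //; exact: cont_cst.
  apply: cont_mul; first exact: cont_cst.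
  apply: cont_add; last by apply: cont_mul => //; exact: cont_cst.
  by apply: cont_sum => i; exact: cont_exp.
have [||c] := @EVT_max_rV R n g (halfcube j) _ (@halfcube_compact j).
- by exists 0; split => [i|]; rewrite mxE // in_itv /= lerN10 ler01.
- exact: continuous_subspaceT.
rewrite inE => -[ci cj] cmax.
have M0 : 0 <= M by exact: le_trans (normr_ge0 _) (fM 0).
have K0 : 0 <= K by exact: le_trans (normr_ge0 _) (fK 0).
suff gc : g c <= 0.
  move=> y Dy; rewrite -subr_le0 mulrC [x0 + y]addrC; apply: le_trans gc.
  by apply: cmax; rewrite inE.
have cj1 : c 0 j <= 1 by have := ci j; rewrite in_itv /= => /andP[].
have bump0 : 0 <= c 0 j - c 0 j ^+ 2.
  by rewrite expr2 -[X in X - _]mulr1 -mulrBr mulr_ge0// subr_ge0.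
have sum0 i : c 0 i ^+ 2 <= \sum_i c 0 i ^+ 2.
  by rewrite (bigD1 i)//= lerDl sumr_ge0// => k _; rewrite sqr_ge0.
have half a b : `|a| <= M -> `|b| <= M -> 2^-1 * (a - b) <= M.
  by rewrite !ler_norml => /andP[? ?] /andP[? ?]; lra.
have big i : 1 <= c 0 i ^+ 2 -> g c <= 0.
  move=> ci1; rewrite subr_le0; apply: (le_trans (half _ _ (fM _) (fM _))).
  rewrite /psi; apply: (@le_trans _ _ (M * (\sum_i c 0 i ^+ 2))).
    by rewrite ler_peMr// (le_trans ci1).
  rewrite -[X in X <= _]addr0 lerD//.
    by rewrite ler_wpM2l// lerDl mulr_ge0.
  by rewrite mulr_ge0// divr_ge0// addr_ge0.
have [cj0|cj0] := eqVneq (c 0 j) 0.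
  have -> : g c = - (M * \sum_i c 0 i ^+ 2).
    rewrite /g (_ : refl j x0 c = c + x0); last first.
      by rewrite /refl cj0 mulr0 scale0r subr0 addrC.
    by rewrite subrr mulr0 sub0r /psi cj0 expr0n /= subr0 !mulr0 !addr0.
  by rewrite oppr_le0 mulr_ge0// sumr_ge0// => k _; rewrite sqr_ge0.
have [/existsP[i ci1]|/existsPn nci] := boolP [exists i, 1 <= c 0 i ^+ 2].
  exact: big ci1.
have cjp : 0 < c 0 j by rewrite lt_neqAle eq_sym cj0.
have ciL i : `|c 0 i| < 1.
  have := nci i; rewrite -ltNge -real_normK ?num_real// => H.
  by rewrite -(@ltr_pXn2r _ 2%N) ?nnegrE// expr1n.
suff : \sum_i ddg i c <= 0 by rewrite leNgt lapg.
apply: sumr_le0 => i _.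
(* A displacement shorter than this along any axis [i] stays in the half cube. *)
pose r := Num.min (1 - `|c 0 i|) (c 0 j).
have r0 : 0 < r by rewrite lt_min cjp andbT subr_gt0.
apply: (derive2_at_max r0 (Hg i) (Hdg i c)) => t tr.
have tr1 : `|t| < 1 - `|c 0 i| by rewrite (lt_le_trans tr)// ge_min lexx.
have tr2 : `|t| < c 0 j by rewrite (lt_le_trans tr)// ge_min lexx orbT.
apply: cmax; rewrite inE; split => [k|]; rewrite !mxE eqxx /=.
  have [->|ki] := eqVneq k i.
    rewrite mulr1 in_itv /= -ler_norml (le_trans (ler_normD _ _))//.
    by move: tr1; move: `|t| `|c 0 i| => a b; lra.
  by rewrite mulr0 addr0; exact: ci.
have := ltr_norml t (c 0 j); rewrite tr2 => /esym/andP[? ?].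
by case: (j == i) => /=; lra.
Qed.

(** At the point t e_j, half the symmetric difference of [f] is [t] times its derivative at a nearby
    point, whereas the barrier is at most [t] times the stated bound: its slope at 0 is M n + (K +
    1) / 2, and the additional [M] absorbs the quadratic term M t^2. If the bound failed at [x0], it
    would fail at nearby points by continuity. *)
Lemma C2_gradient_bound f (M K : R) : C2 f -> (forall y, `|f y| <= M) ->
  (forall y, `|laplacian f y| <= K) ->
  forall j x0, partial j f x0 <= M * (n.+1)%:R + (K + 1) / 2.
Proof.
move=> fC2 fM fK j x0.
rewrite leNgt; apply/negP; set C := _ + _ => big.
have N : nbhs x0 [set z | C < partial j f z].
  apply: (open_nbhs_nbhs (conj _ _)) => //.
  apply: (@open_comp _ _ (partial j f) [set z | C < z]); last exact: open_gt.
  by move=> y _; exact: (fC2.1 j).2.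
have [d /= d0 dP] := (@nbhs_ballP R 'rV[R]_n _ _).1 N.
pose t : R := Num.min 1 d / 2.
have m0 : 0 < Num.min 1 d by rewrite lt_min ltr01 d0.
have t0 : 0 < t by rewrite divr_gt0.
have t1 : t < 1.
  have : Num.min 1 d <= 1 by rewrite ge_min lexx.
  by rewrite /t; lra.
have td : t < d.
  have : Num.min 1 d <= d by rewrite ge_min lexx orbT.
  by rewrite /t; lra.
have nb : `|basis_vec j : 'rV[R]_n| <= 1.
  by apply: norm_le_coord => // p; rewrite basis_vecE; case: eqP; rewrite ?normr1 ?normr0.
have [s /andP[s0 s1] E] := @MVT_along R n f (x0 - t *: basis_vec j) (basis_vec j) (2 * t)
  (partial j f) (fun y => derivableP (proj1 (fC2.1 j) y)).
have := @odd_barrier f M K j x0 fC2 fM fK (t *: basis_vec j).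
rewrite /refl !mxE !eqxx mulr1.
have -> : x0 + t *: basis_vec j - (2 * t) *: basis_vec j = x0 - t *: basis_vec j.
  by rewrite -addrA -scalerBl (_ : t - 2 * t = - t) ?scaleNr//; ring.
have -> : f (x0 + t *: basis_vec j) - f (x0 - t *: basis_vec j) =
    2 * t * partial j f (x0 + ((2 * s - 1) * t) *: basis_vec j).
  rewrite (_ : x0 + t *: _ = x0 - t *: basis_vec j + (2 * t) *: basis_vec j); last first.
    by rewrite -addrA -scaleNr -scalerDl; congr (_ + _ *: _); ring.
  rewrite E; congr (_ * partial j f _).
  by rewrite -addrA -scaleNr -scalerDl; congr (_ + _ *: _); ring.
have Ct : C < partial j f (x0 + ((2 * s - 1) * t) *: basis_vec j).
  apply: dP; rewrite -ball_normE /= opprD addrA subrr sub0r normrN normrZ.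
  apply: le_lt_trans td; rewrite -[X in _ <= X]mulr1 ler_pM// normrM (gtr0_norm t0).
  apply: ler_piMl; first exact: ltW.
  by rewrite ler_norml; apply/andP; split; lra.
have Hc : halfcube j (t *: basis_vec j).
  split => [i|]; rewrite !mxE eqxx /=; last by rewrite eqxx mulr1 ltW.
  rewrite in_itv /=; case: (i == j); rewrite ?mulr1n ?mulr0n ?mulr1 ?mulr0; apply/andP; split; lra.
move=> /(_ Hc); rewrite /psi (bigD1 j)//= !mxE !eqxx big1 => [|i ij]; last first.
  by rewrite !mxE eqxx (negbTE ij) mulr0 expr0n.
set D := partial j f _ in Ct *; rewrite mulr1 addr0 => H.
have M0 : 0 <= M by exact: le_trans (normr_ge0 _) (fM 0).
have K0 : 0 <= K by exact: le_trans (normr_ge0 _) (fK 0).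
have n0 : 0 <= n%:R :> R by exact: ler0n.
have h1 : 0 <= M * t * (1 - t) by rewrite !mulr_ge0// ?subr_ge0 ltW.
have h2 : 0 <= M * n%:R * t ^+ 2 by rewrite !mulr_ge0// ltW.
have h3 : 0 <= (K + 1) * t ^+ 2 by rewrite !mulr_ge0 ?addr_ge0// ltW.
have : t * D <= t * C.
  rewrite /C -natr1; move: (n%:R) n0 h2 H => N' n0 h2 H; lra.
by rewrite ler_pM2l// leNgt Ct.
Qed.

End GradientBound.

(** * Nondegenerate wells *)

Section EuclideanNorm.
Context {R : realType} {m : nat}.
Implicit Types (x y v : 'rV[R]_m).

Lemma dotv_ge0 y : 0 <= dotv y y.
Proof. by apply: sumr_ge0 => i _; rewrite -expr2 sqr_ge0. Qed.

Lemma sqr_enorm y : enorm y ^+ 2 = dotv y y.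
Proof. by rewrite sqr_sqrtr// dotv_ge0. Qed.

Lemma enorm_ge0 y : 0 <= enorm y.
Proof. exact: sqrtr_ge0. Qed.

Lemma coord_le_dotv y i : y 0 i ^+ 2 <= dotv y y.
Proof.
by rewrite /dotv (bigD1 i)//= -expr2 lerDl sumr_ge0// => k _; rewrite -expr2 sqr_ge0.
Qed.

Lemma coord_le_enorm y i : `|y 0 i| <= enorm y.
Proof.
rewrite -(@ler_pXn2r _ 2%N) ?nnegrE ?enorm_ge0//.
by rewrite real_normK ?num_real// sqr_enorm coord_le_dotv.
Qed.

Lemma norm_le_enorm y : `|y| <= enorm y.
Proof. by apply: norm_le_coord; [exact: enorm_ge0|exact: coord_le_enorm]. Qed.

Lemma dotv_eq0 y : dotv y y = 0 -> y = 0.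
Proof.
move=> y0; apply/rowP => i; rewrite mxE; apply/eqP; rewrite -sqrf_eq0.
by rewrite eq_le sqr_ge0 -y0 coord_le_dotv.
Qed.

Lemma dotvZ (s : R) x y : dotv (s *: x) y = s * dotv x y.
Proof. by rewrite mulr_sumr; apply: eq_bigr => i _; rewrite mxE mulrA. Qed.

Lemma dotvC x y : dotv x y = dotv y x.
Proof. by apply: eq_bigr => i _; rewrite mulrC. Qed.

Lemma cont_dotv : continuous (fun y : 'rV[R]_m => dotv y y).
Proof. by apply: cont_sum => i; apply: cont_mul; exact: cont_coord. Qed.

End EuclideanNorm.

Section Well.
Context {R : realType} {m : nat}.
Implicit Types (W : 'rV[R]_m -> R) (v y nu : 'rV[R]_m).

Lemma deriv_direction W v y : C1 W ->
  is_derive v y W (\sum_l y 0 l * partial l W v).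
Proof.
by move=> WC1; apply: (is_derive_chain (g := id) WC1) => l; exact: deriv_coord.
Qed.

(** The quadratic form of the Hessian, arranged as the second derivative of [W] along [y] that two
    uses of [deriv_direction] produce. *)
Let qf W v y := \sum_j y 0 j * \sum_i y 0 i * partial i (partial j W) v.

Let qfE W v y : dotv (y *m hessian W v) y = qf W v y.
Proof.
rewrite /dotv /qf; apply: eq_bigr => j _; rewrite !mxE mulrC; congr (_ * _).
by apply: eq_bigr => i _; rewrite mxE.
Qed.

Let cont_qf W v : continuous (qf W v).
Proof.
apply: cont_sum => j; apply: cont_mul; first exact: cont_coord.
by apply: cont_sum => i; apply: cont_mul; [exact: cont_coord|exact: cont_cst].
Qed.

Let qfZ W v (s : R) y : qf W v (s *: y) = s ^+ 2 * qf W v y.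
Proof.
rewrite mulr_sumr; apply: eq_bigr => j _; rewrite !mxE !mulr_sumr.
by apply: eq_bigr => i _; rewrite mxE; ring.
Qed.

(** The constant is the minimum of the form on the unit sphere, compact and nonempty since [m] is
    positive; homogeneity extends the bound to all vectors. *)
Lemma hessian_coercive W v : (0 < m)%N ->
  (forall nu, enorm nu = 1 -> 0 < dotv (nu *m hessian W v) nu) ->
  exists2 c : R, 0 < c & forall y, c * dotv y y <= dotv (y *m hessian W v) y.
Proof.
move=> m0 pos.
have cS : compact [set y : 'rV[R]_m | dotv y y = 1].
  apply: bounded_closed_compact.
    exists 1; split; first exact: num_real.
    move=> M M1 y y1 /=; apply: le_trans (ltW M1).
    by apply: (le_trans (norm_le_enorm y)); rewrite /enorm y1 sqrtr1.
  apply: (@closed_comp _ _ (fun y : 'rV[R]_m => dotv y y) [set 1]).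
    by move=> y _; exact: cont_dotv.
  exact: closed_eq.
have [||c] := @EVT_min_rV R m (qf W v) _ _ cS.
- exists (basis_vec (Ordinal m0)); rewrite /= /dotv (bigD1 (Ordinal m0))//= big1.
    by rewrite basis_vecE eqxx addr0 mulr1.
  by move=> i i0; rewrite basis_vecE (negbTE i0) mulr0.
- by apply: continuous_subspaceT => y; exact: cont_qf.
rewrite inE /= => c1 cmin.
have c0 : 0 < qf W v c by rewrite -qfE pos// /enorm c1 sqrtr1.
exists (qf W v c) => // y; rewrite qfE.
have [/eqP/dotv_eq0 ->|y0] := boolP (dotv y y == 0).
  by rewrite -(scale0r 0) qfZ dotvZ !(mul0r, expr0n, mulr0).
have e0 : 0 < enorm y by rewrite sqrtr_gt0 lt_neqAle eq_sym y0 dotv_ge0.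
have -> : y = enorm y *: ((enorm y)^-1 *: y).
  by rewrite scalerA mulfV ?scale1r// gt_eqF.
set z := _^-1 *: y.
have z1 : dotv z z = 1.
  by rewrite dotvZ dotvC dotvZ -sqr_enorm; field; rewrite gt_eqF.
rewrite qfZ dotvZ dotvC dotvZ z1 mulr1 -expr2 mulrC ler_pM2l ?exprn_gt0//.
by apply: cmin; rewrite inE.
Qed.

(** Near [a] the Hessian form stays above half its coercivity constant. Integrating along the
    segment from [a], where the gradient vanishes, bounds the radial derivative of [W] from below,
    and a second integration bounds [W] itself. *)
Lemma nondegenerate_well W (a : 'rV[R]_m) : (0 < m)%N -> C2 W ->
  (forall v, 0 <= W v) -> W a = 0 ->
  (forall nu, enorm nu = 1 -> 0 < dotv (nu *m hessian W a) nu) ->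
  exists d c : R, [/\ 0 < d, 0 < c & forall v, dotv (v - a) (v - a) < d ->
    c * dotv (v - a) (v - a) <= W v /\ 0 <= dotv (gradient W v) (v - a)].
Proof.
move=> m0 [WC1 WC2] W0 Wa pos.
have [c c0 cP] := hessian_coercive m0 pos.
(* Changing each entry of the Hessian by at most [e] changes the form by at most e m |y|^2 = (c / 2)
   |y|^2. *)
pose e : R := c / (2 * m%:R).
have mR : 0 < m%:R :> R by rewrite ltr0n.
have e0 : 0 < e by rewrite divr_gt0// mulr_gt0.
have N : nbhs a [set v | forall ij : 'I_m * 'I_m,
   `|partial ij.1 (partial ij.2 W) a - partial ij.1 (partial ij.2 W) v| <= e].
  apply: (@filter_forall _ _ (fun ij : 'I_m * 'I_m => [set v |
   `|partial ij.1 (partial ij.2 W) a - partial ij.1 (partial ij.2 W) v| <= e])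
    _ (nbhs_filter a)) => -[i j].
  by have [_ /(_ a) /cvgrPdist_le /(_ _ e0)] := WC2 j i.
have [r /= r0 rP] := (@nbhs_ballP R 'rV[R]_m _ _).1 N.
have qf_ge v y : `|v - a| < r -> c / 2 * dotv y y <= qf W v y.
  move=> vr.
  have vP : forall i j, `|partial i (partial j W) a - partial i (partial j W) v| <= e.
    by move=> i j; apply: (rP v _ (i, j)); rewrite -ball_normE /= distrC.
  have H : qf W a y - qf W v y <= c / 2 * dotv y y.
    apply: (@le_trans _ _ (\sum_j \sum_i e * (2^-1 * (y 0 i ^+ 2 + y 0 j ^+ 2)))).
      rewrite /qf -sumrB; apply: ler_sum => j _.
      rewrite -mulrBr -sumrB mulr_sumr; apply: ler_sum => i _.
      rewrite -mulrBr mulrA (le_trans (ler_norm _))// normrM mulrC.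
      apply: ler_pM => //; rewrite normrM -[y 0 i ^+ 2]real_normK ?num_real//.
      rewrite -[y 0 j ^+ 2]real_normK ?num_real//.
      by move: `|y 0 j| `|y 0 i| => s t; have := sqr_ge0 (s - t); rewrite sqrrB; lra.
    have S : \sum_i y 0 i ^+ 2 = dotv y y by apply: eq_bigr => i _; rewrite expr2.
    under eq_bigr do rewrite -!mulr_sumr big_split /= sumr_const card_ord S.
    rewrite -!mulr_sumr big_split /= sumr_const card_ord.
    under [X in _ + X]eq_bigr do rewrite -mulr_natr.
    rewrite -mulr_suml S -mulr_natr /e.
    rewrite le_eqVlt; apply/orP; left; apply/eqP; field.
    by rewrite gt_eqF.
  move: H (cP y); rewrite qfE.
  by move: (qf W a y) (qf W v y) (dotv y y) => q1 q2 n2; lra.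
exists (r ^+ 2), (c / 4); split; [exact: exprn_gt0|exact: divr_gt0|].
move=> v vr; set y := v - a.
have yr : `|y| < r.
  apply: (le_lt_trans (norm_le_enorm y)).
  by rewrite -(@ltr_pXn2r _ 2%N) ?nnegrE ?enorm_ge0 ?ltW// sqr_enorm.
pose G v := \sum_l y 0 l * partial l W v.
have dW z : is_derive z y W (G z) by exact: deriv_direction.
have dG z : is_derive z y G (qf W z y).
  exact: (deriv_sum (fun l => deriv_scale _ (deriv_direction z y (WC2 l)))).
have Ga : G a = 0.
  have dl (t : R) : is_derive t 1 (fun t => W (a + t *: y)) (G (a + t *: y)).
    exact/is_derive_along.
  have n1 : - 1 < 1 :> R by lra.
  have i0 : (0 : R) \in `]-1, 1[ by rewrite in_itv /=; apply/andP; split; lra.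
  have M (t : R) : t \in `]-1, 1[ -> W (a + 0 *: y) <= W (a + t *: y).
    by move=> _; rewrite scale0r addr0 Wa.
  have [_ E0] := derive1_at_min (ltW n1) (fun t _ => @ex_derive _ _ _ _ _ _ _ (dl t)) i0 M.
  by have [_] := dl 0; rewrite E0 scale0r addr0.
have Gt (t : R) : 0 < t <= 1 -> t * (c / 2 * dotv y y) <= G (a + t *: y).
  move=> /andP[t0 t1].
  have [s /andP[s0 s1] Es] := @MVT_along R m G a y t _ dG.
  rewrite -[leRHS]subr0 -Ga Es ler_pM2l//; apply: qf_ge.
  rewrite [a + _]addrC addrK normrZ; apply: le_lt_trans yr.
  apply: ler_piMl => //; rewrite ger0_norm; last by rewrite mulr_ge0// ltW.
  by apply: mulr_ile1 => //; exact: ltW.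
have ay : a + 1 *: y = v by rewrite scale1r addrC subrK.
split; last first.
  have -> : dotv (gradient W v) y = G v.
    by apply: eq_bigr => l _; rewrite mxE mulrC.
  rewrite -ay; apply: le_trans (Gt 1 _); last by rewrite ltr01 lexx.
  by rewrite mul1r mulr_ge0 ?dotv_ge0// divr_ge0// ltW.
(* The subtracted term has derivative s (c / 2) |y|^2 at [a + s *: y], exactly the lower bound known
   for [G]; hence the derivative of [Phi] along the segment is nonnegative. *)
pose Phi (z : 'rV[R]_m) := W z - c / 4 * \sum_l (z 0 l - a 0 l) ^+ 2.
have dPhi z : is_derive z y Phi
    (G z - c / 4 * \sum_l 2 * ((z 0 l - a 0 l) * (y 0 l - 0))).
  exact: (deriv_sub (dW z) (deriv_scale _ (deriv_sum (fun l => deriv_sqr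
    (deriv_sub (deriv_coord l z y) (deriv_cst _ _ _)))))).
have [s /andP[s0 s1]] := @MVT_along R m Phi a y 1 _ dPhi.
have Sy (z : 'rV[R]_m) : \sum_l (z 0 l - a 0 l) ^+ 2 = dotv (z - a) (z - a).
  by apply: eq_bigr => l _; rewrite !mxE expr2.
rewrite ay mulr1 mul1r /Phi Sy Sy Wa subrr sub0r.
have -> : dotv (0 : 'rV[R]_m) 0 = 0 by rewrite -(scale0r 0) dotvZ mul0r.
have -> : \sum_l 2 * (((a + s *: y) 0 l - a 0 l) * (y 0 l - 0)) = 2 * (s * dotv y y).
  rewrite -mulr_sumr; congr (_ * _); rewrite mulr_sumr; apply: eq_bigr => l _.
  by rewrite !mxE; ring.
have := Gt s; rewrite s0 (ltW s1) => /(_ isT); rewrite -/y.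
move: (G _) (dotv y y) => g n2; lra.
Qed.

End Well.

(** * Weighted integral identities *)

Section PositivePart.
Context {R : realType}.
Implicit Types t : R.

(** Squaring makes the positive part C^1: at 0 the difference quotient is at most |h| in absolute
    value. *)
Lemma deriv_pos_sqr t :
  is_derive t 1 (fun t : R => Num.max 0 t ^+ 2) (2 * Num.max 0 t).
Proof.
have near_pos (A : set R) : open A -> A t -> nbhs t A.
  by move=> oA At; exact: open_nbhs_nbhs.
have [t0|t0|->] := ltgtP t 0.
- have E : {near t, (fun=> 0 : R) =1 (fun t : R => Num.max 0 t ^+ 2)}.
    have : nbhs t [set z : R | z < 0] by apply: near_pos => //; exact: open_lt.
    by apply: filterS => z /= z0; rewrite max_l ?expr0n// ltW.
  rewrite mulr0.
  by apply: (near_eq_is_derive E _); rewrite ?oner_neq0//; exact: deriv_cst.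
- have E : {near t, (fun z : R => z ^+ 2) =1 (fun t : R => Num.max 0 t ^+ 2)}.
    have : nbhs t [set z : R | 0 < z] by apply: near_pos => //; exact: open_gt.
    by apply: filterS => z /= z0; rewrite max_r// ltW.
  apply: (near_eq_is_derive E _); rewrite ?oner_neq0//.
  by apply: (is_derive_eq (deriv_sqr (is_derive_id t 1))); rewrite mulr1.
have C : (fun h : R => h^-1 *: (((fun t : R => Num.max 0 t ^+ 2) \o shift 0) (h *: (1 : R))
     - Num.max 0 0 ^+ 2)) @ 0^' --> (0 : R).
  rewrite maxxx; apply/cvgrPdist_lt => e e0.
  exists e => //= h; rewrite /ball_ /= !sub0r !normrN => he h0.
  rewrite addr0 [h *: 1]mulr1 expr0n subr0 normrM normfV.
  rewrite ltr_pdivrMl ?normr_gt0// normrX.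
  have [h1|h1] := leP h 0; first by rewrite normr0 expr0n mulr_gt0 ?normr_gt0.
  by rewrite expr2 ltr_pM2l ?normr_gt0.
rewrite mulr0; split; first by apply/cvg_ex; exists 0.
exact: cvg_lim.
Qed.

Lemma pos_sqr t : Num.max 0 t * t = Num.max 0 t ^+ 2.
Proof. by have [z0|z0] := leP t 0; rewrite ?mul0r ?expr0n ?expr2. Qed.

End PositivePart.

(** * The quadratic cutoff and Green's formula *)

Section Cutoff.
Context {R : realType} {n : nat}.
Implicit Types (c x : 'rV[R]_n) (r : R).

Definition cutoff c r x : R := Num.max 0 (r ^+ 2 - dotv (x - c) (x - c)).

Lemma cutoff_ge0 c r x : 0 <= cutoff c r x.
Proof. by rewrite le_max lexx. Qed.

Lemma cont_cutoff c r : continuous (cutoff c r).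
Proof.
apply: cont_pos; apply: cont_sub; first exact: cont_cst.
by apply: (cont_comp cont_dotv); exact: cont_translation.
Qed.

Lemma cutoff_eq0 c r x : 0 <= r -> r <= enorm (x - c) -> cutoff c r x = 0.
Proof.
move=> r0 rx; apply: max_l; rewrite subr_le0 -sqr_enorm.
by rewrite ler_pXn2r ?nnegrE ?enorm_ge0.
Qed.

Lemma test_fun_cutoff c r : 0 <= r -> test_fun (cutoff c r).
Proof.
move=> r0; split; first exact: cont_cutoff.
exists (r + `|c|) => x xr; apply: cutoff_eq0 => //.
apply: (le_trans _ (norm_le_enorm _)).
by have := ler_normD (x - c) c; rewrite subrK; lra.
Qed.

Lemma test_fun_cutoff2 c r : 0 <= r -> test_fun (fun x => cutoff c r x ^+ 2).
Proof.
move=> r0; have [ck sk] := test_fun_cutoff c r0.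
by have := test_fun_mul (conj ck sk) ck; under eq_fun do rewrite -expr2.
Qed.

Lemma cutoff_coord c r x i : 0 <= r -> cutoff c r x * `|x 0 i - c 0 i| <= cutoff c r x * r.
Proof.
move=> r0; have [xr|xr] := leP r (enorm (x - c)).
  by rewrite cutoff_eq0// !mul0r.
rewrite ler_wpM2l ?cutoff_ge0//; apply: le_trans (ltW xr).
by have := coord_le_enorm (x - c) i; rewrite !mxE.
Qed.

Lemma deriv_dist2 c x i : is_derive x (basis_vec i)
  (fun x => dotv (x - c) (x - c)) (2 * (x 0 i - c 0 i)).
Proof.
rewrite (_ : (fun _ => _) = fun x : 'rV[R]_n => \sum_l (x 0 l - c 0 l) ^+ 2); last first.
  by apply/funext => z; apply: eq_bigr => l _; rewrite !mxE expr2.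
have S := deriv_sum (fun l => deriv_sqr (deriv_sub (deriv_coord l x (basis_vec i))
  (deriv_cst (c 0 l) _ _))).
apply: (is_derive_eq S).
rewrite (bigD1 i)//= big1 ?addr0 => [|l li]; last first.
  by rewrite basis_vecE (negbTE li) subr0 !mulr0.
by rewrite basis_vecE eqxx subr0 mulr1.
Qed.

Lemma deriv_cutoff2 c r x i : is_derive x (basis_vec i)
  (fun x => cutoff c r x ^+ 2) (- 4 * cutoff c r x * (x 0 i - c 0 i)).
Proof.
have S := deriv_sub (deriv_cst (r ^+ 2) x (basis_vec i)) (deriv_dist2 c x i).
apply: (is_derive_eq (is_derive_comp1 (deriv_pos_sqr _) S)).
by rewrite /cutoff; ring.
Qed.

(** Trades the squared distance that arises in Pohozaev's identity for r^2 and one more cutoff, so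
    that the identity closes on the two weighted integrals. *)
Lemma cutoff_dist2 c r x :
  cutoff c r x * dotv (x - c) (x - c) = r ^+ 2 * cutoff c r x - cutoff c r x ^+ 2.
Proof. by rewrite -[in RHS]pos_sqr -/(cutoff _ _ _); ring. Qed.

(** The divergence of the field [cutoff ^+ 2 * dP] has integral zero, and the gradient of
    [cutoff ^+ 2] is -4 [cutoff] times the position. The field [dP] stands for the gradient of a
    potential. *)
Lemma green_cutoff c r (dP ddP : 'I_n -> 'rV[R]_n -> R) : 0 <= r ->
  (forall i x, is_derive x (basis_vec i) (dP i) (ddP i x)) ->
  (forall i, continuous (dP i)) -> (forall i, continuous (ddP i)) ->
  Rintegral_Rn (fun x => cutoff c r x ^+ 2 * \sum_i ddP i x) =
  4 * Rintegral_Rn (fun x => cutoff c r x * \sum_i (x 0 i - c 0 i) * dP i x).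
Proof.
move=> r0 Hd cd cdd.
have tq := test_fun_cutoff c r0; have th := test_fun_cutoff2 c r0.
have cX i : continuous (fun x : 'rV[R]_n => x 0 i - c 0 i).
  by apply: cont_sub; [exact: cont_coord|exact: cont_cst].
pose F i x := - 4 * cutoff c r x * (x 0 i - c 0 i) * dP i x +
  cutoff c r x ^+ 2 * ddP i x.
have dF i x : is_derive x (basis_vec i) (fun x => cutoff c r x ^+ 2 * dP i x) (F i x).
  exact: (deriv_mul (deriv_cutoff2 c r x i) (Hd i x)).
have cF i : continuous (F i).
  apply: cont_add; last by apply: cont_mul => //; exact: th.1.
  apply: cont_mul => //; apply: cont_mul => //.
  by apply: cont_mul; [exact: cont_cst|exact: tq.1].
have sF i : compact_supp (fun x => cutoff c r x ^+ 2 * dP i x).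
  exact: (test_fun_mul th (cd i)).2.
have : Rintegral_Rn (fun x => \sum_i F i x) = 0.
  rewrite Rintegral_Rn_sum => [|i]; last exact: test_fun_partial (dF i) (cF i) (sF i).
  by rewrite big1// => i _; exact: Rintegral_Rn_partial (dF i) (cF i) (sF i).
have t1 : test_fun (fun x => cutoff c r x * \sum_i (x 0 i - c 0 i) * dP i x).
  by apply: test_fun_mul => //; apply: cont_sum => i; exact: cont_mul.
have t2 : test_fun (fun x => cutoff c r x ^+ 2 * \sum_i ddP i x).
  by apply: test_fun_mul => //; exact: cont_sum.
rewrite (_ : (fun x => \sum_i F i x) = fun x =>
    -4 * (cutoff c r x * \sum_i (x 0 i - c 0 i) * dP i x) +
    cutoff c r x ^+ 2 * \sum_i ddP i x).
  rewrite Rintegral_Rn_add//; last exact: test_fun_scale.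
  by rewrite Rintegral_Rn_scale// => H; lra.
apply/funext => x; rewrite big_split /= !mulr_sumr; congr (_ + _).
by apply: eq_bigr => i _; ring.
Qed.

End Cutoff.

(** * Pointwise algebra of the stress tensor *)

Section Pohozaev.
Context {R : realType}.

(* [X] is the position, [p i l] and [s i j l] the first and second derivatives
   of the map, [g] the gradient of the potential. *)
Lemma stress_divergence n m (X : 'I_n -> R) (p : 'I_n -> 'I_m -> R)
    (s : 'I_n -> 'I_n -> 'I_m -> R) (g : 'I_m -> R) (q h e : R) :
  (forall i j l, s i j l = s j i l) -> (forall l, \sum_i s i i l = g l) ->
  let Z l := \sum_i X i * p i l in
  \sum_j (- 4 * q * X j * (\sum_l Z l * p j l - e * X j) +
    h * (\sum_l ((\sum_i ((i == j)%:R * p i l + X i * s j i l)) * p j l + Z l * s j j l) -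
      ((\sum_l \sum_i p i l * s j i l + \sum_l p j l * g l) * X j + e))) =
  - 4 * q * (\sum_l Z l ^+ 2 - e * \sum_i X i ^+ 2) +
  h * (\sum_l \sum_i p i l ^+ 2 - n%:R * e).
Proof.
move=> ssym sg Z.
rewrite big_split /= -mulr_sumr; congr (_ + _ * _).
  under [LHS]eq_bigr do rewrite -mulrA mulrBr.
  rewrite -mulr_sumr sumrB; congr (_ * (_ - _)).
    under [LHS]eq_bigr do rewrite mulr_sumr.
    rewrite exchange_big; apply: eq_bigr => l _; rewrite expr2 {3}/Z mulr_sumr.
    by apply: eq_bigr => i _; ring.
  by rewrite mulr_sumr; apply: eq_bigr => i _; ring.
rewrite sumrB.
(* By the symmetry of [s], the divergence of [e X] contains the same second-order terms as that of
   the fields Z_l p_j_l; they cancel below and only first derivatives remain. *)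
have -> : \sum_j ((\sum_l \sum_i p i l * s j i l + \sum_l p j l * g l) * X j + e) =
    \sum_j \sum_l (\sum_i X i * s j i l) * p j l + \sum_l Z l * g l + n%:R * e.
  rewrite big_split /= sumr_const card_ord -[e *+ n]mulr_natl; congr (_ + _).
  under [LHS]eq_bigr do rewrite mulrDl.
  rewrite big_split /=; congr (_ + _).
    under [LHS]eq_bigr do rewrite mulr_suml.
    rewrite exchange_big [RHS]exchange_big; apply: eq_bigr => l _ /=.
    under [LHS]eq_bigr do rewrite mulr_suml.
    under [RHS]eq_bigr do rewrite mulr_suml.
    rewrite exchange_big; apply: eq_bigr => i _; apply: eq_bigr => j _.
    by rewrite ssym; ring.
  under [LHS]eq_bigr do rewrite mulr_suml.
  rewrite exchange_big; apply: eq_bigr => l _ /=; rewrite mulr_suml.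
  by apply: eq_bigr => i _; ring.
under [X in X - _]eq_bigr do rewrite big_split /=.
rewrite big_split /= opprD addrA; congr (_ - _).
have -> : \sum_j \sum_l Z l * s j j l = \sum_l Z l * g l.
  by rewrite exchange_big; apply: eq_bigr => l _; rewrite -mulr_sumr sg.
rewrite opprD addrACA subrr addr0 -sumrB [RHS]exchange_big; apply: eq_bigr => j _.
rewrite -sumrB; apply: eq_bigr => l _; rewrite -mulrBl big_split /= addrK.
rewrite (bigD1 j)//= eqxx big1 ?addr0 => [|i ij]; last by rewrite (negbTE ij) mul0r.
by rewrite mul1r expr2.
Qed.

End Pohozaev.

(** Lagrange's identity: the double sum of squares is twice the difference of the two sides. *)
Lemma cauchy_schwarz {R : realType} m (a b : 'I_m -> R) :
  (\sum_l a l * b l) ^+ 2 <= (\sum_l a l ^+ 2) * \sum_l b l ^+ 2.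
Proof.
have : 0 <= \sum_l \sum_k (a l * b k - a k * b l) ^+ 2.
  by apply: sumr_ge0 => l _; apply: sumr_ge0 => k _; exact: sqr_ge0.
have -> : \sum_l \sum_k (a l * b k - a k * b l) ^+ 2 =
   \sum_l \sum_k (a l ^+ 2 * b k ^+ 2 + (- 2 * (a l * b l) * (a k * b k) + b l ^+ 2 * a k ^+ 2)).
  by apply: eq_bigr => l _; apply: eq_bigr => k _; ring.
under eq_bigr do rewrite big_split big_split /= -!mulr_sumr.
rewrite big_split big_split /= -!mulr_suml -mulr_sumr expr2.
move: (\sum_l a l ^+ 2) (\sum_l b l ^+ 2) (\sum_l a l * b l) => A B D; lra.
Qed.

Section Components.
Context {R : realType} {n m : nat}.
Implicit Types (u : 'rV[R]_n -> 'rV[R]_m).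

Lemma partial_component u i l : C1 u ->
  partial i (component u l) = fun x => partial i u x 0 l.
Proof.
move=> uC1; apply/funext => x; rewrite /partial derive_mx ?mxE//.
exact: (uC1 i).1.
Qed.

Lemma C1_component u l : C1 u -> C1 (component u l).
Proof.
move=> uC1 i; split => [x|].
  by have /derivable_mxP := (uC1 i).1 x; exact.
rewrite partial_component//.
exact: (cont_comp (@cont_coord R m l) (uC1 i).2).
Qed.

Lemma C2_component u l : C2 u -> C2 (component u l).
Proof.
move=> [uC1 uC2]; split; first exact: C1_component.
by move=> i; rewrite partial_component//; exact: C1_component (uC2 i).
Qed.

Lemma cont_vector u : (forall l, continuous (component u l)) -> continuous u.
Proof.
move=> cu x; have FF := nbhs_filter x; apply/(cvgrPdist_lt (FF := FF)) => e e0.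
have N : nbhs x [set z | forall l, `|component u l x - component u l z| < e].
  apply: (@filter_forall _ 'I_m (fun (l : 'I_m) => [set z : 'rV[R]_n |
    `|component u l x - component u l z| < e]) _ FF) => l.
  by have /cvgrPdist_lt/(_ _ e0) := cu l x.
apply: filterS N => z zP; apply: norm_lt_coord => // l.
by have := zP l; rewrite /component !mxE.
Qed.

Lemma C1_continuous (f : 'rV[R]_n -> R) : C1 f -> continuous f.
Proof. by move=> fC1 x; exact: differentiable_continuous (C1_differentiable x fC1). Qed.

Lemma C1_deriv (f : 'rV[R]_n -> R) i x : C1 f ->
  is_derive x (basis_vec i) f (partial i f x).
Proof. by move=> fC1; apply: derivableP; exact: (fC1 i).1. Qed.

End Components.

Lemma ex2_and (T : Type) (P Q : T -> Prop) : (exists2 x, P x & Q x) -> exists x, P x /\ Q x.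
Proof. by move=> [x Px Qx]; exists x. Qed.

Section Opposite.
Context {R : realType} {n : nat}.
Implicit Types (f : 'rV[R]_n -> R).

Lemma partial_opp f i : C1 f -> partial i (fun x => - f x) = fun x => - partial i f x.
Proof.
move=> fC1; apply/funext => x; rewrite /partial -deriveN//.
exact: (fC1 i).1.
Qed.

Lemma C1_opp f : C1 f -> C1 (fun x => - f x).
Proof.
move=> fC1 i; split => [x|]; first by apply: derivableN; exact: (fC1 i).1.
rewrite partial_opp// => x; have cx := (fC1 i).2 x; exact: (cvgN cx).
Qed.

Lemma C2_opp f : C2 f -> C2 (fun x => - f x).
Proof.
move=> [fC1 fC2]; split; first exact: C1_opp.
by move=> i; rewrite (partial_opp i fC1); exact: C1_opp (fC2 i).
Qed.

Lemma laplacian_opp f x : C2 f -> laplacian (fun x => - f x) x = - laplacian f x.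
Proof.
move=> [fC1 fC2]; rewrite /laplacian -sumrN; apply: eq_bigr => i _.
by rewrite (partial_opp i fC1) (partial_opp i (fC2 i)).
Qed.

Lemma C2_gradient_bound_norm f (M K : R) : C2 f -> (forall y, `|f y| <= M) ->
  (forall y, `|laplacian f y| <= K) ->
  forall j x, `|partial j f x| <= M * n.+1%:R + (K + 1) / 2.
Proof.
move=> fC2 fM fK j x; rewrite ler_norml (C2_gradient_bound fC2 fM fK) andbT lerNl.
have := C2_gradient_bound (C2_opp fC2) (M := M) (K := K) _ _ j x.
rewrite partial_opp; last exact: fC2.1.
by apply => z; rewrite ?laplacian_opp// normrN.
Qed.

Lemma compact_enorm_ball (M : R) : compact [set v : 'rV[R]_n | enorm v <= M].
Proof.
apply: bounded_closed_compact.
  exists M; split; first exact: num_real.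
  by move=> M' MM' v /= vM; exact: le_trans (norm_le_enorm v) (le_trans vM (ltW MM')).
have [M0|M0] := ltP M 0.
  rewrite (_ : [set v | _] = set0); first exact: closed0.
  by apply/seteqP; split => // v /= vM; have := le_lt_trans vM M0; rewrite ltNge enorm_ge0.
rewrite (_ : [set v | _] = [set v : 'rV[R]_n | dotv v v <= M ^+ 2]); last first.
  by apply/seteqP; split => v /=; rewrite -sqr_enorm ler_pXn2r ?nnegrE ?enorm_ge0.
apply: (@closed_comp _ _ (fun v : 'rV[R]_n => dotv v v) [set z | z <= M ^+ 2]).
  by move=> v _; exact: cont_dotv.
exact: closed_le.
Qed.

Lemma bounded_on_enorm_ball f (M : R) : continuous f ->
  exists K : R, forall v, enorm v <= M -> `|f v| <= K.
Proof.
move=> cf; have [[v0 v0M]|noM] := pselect (exists v : 'rV[R]_n, enorm v <= M); last first.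
  by exists 0 => v vM; case: noM; exists v.
have [||c _ cmax] := @EVT_max_rV R n (fun v => `|f v|) _ _ (@compact_enorm_ball M).
- by exists v0.
- apply: continuous_subspaceT; apply: cont_comp cf => x; exact: norm_continuous.
by exists `|f c| => v vM; apply: cmax; rewrite inE.
Qed.

End Opposite.

(** * Pohozaev's identity and well potentials for a solution *)

Section System.
Context {R : realType} {n m : nat}.
Context (W : 'rV[R]_m -> R) (u : 'rV[R]_n -> 'rV[R]_m).
Context (W_C1 : C1 W) (u_C2 : C2 u)
  (u_solution : forall x, vlaplacian u x = gradient W (u x)).
Implicit Types (x c : 'rV[R]_n) (r : R) (i j : 'I_n) (l : 'I_m).

Let U l x := u x 0 l.
Let p i l x := partial i (component u l) x.
Let s i j l x := partial i (partial j (component u l)) x.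
Let g l x := partial l W (u x).
Let w x := W (u x).
Let e := energy_density W u.

Let deriv_U i l x : is_derive x (basis_vec i) (U l) (p i l x).
Proof. exact: C1_deriv (C2_component l u_C2).1. Qed.

Let deriv_p i j l x : is_derive x (basis_vec i) (p j l) (s i j l x).
Proof. by apply: C1_deriv; exact: (C2_component l u_C2).2. Qed.

Let deriv_w i x : is_derive x (basis_vec i) w (\sum_l p i l x * g l x).
Proof. by apply: is_derive_chain => // l; exact: deriv_U. Qed.

Let s_sym i j l x : s i j l x = s j i l x.
Proof. exact: C2_partial_sym (C2_component l u_C2). Qed.

Let sum_s l x : \sum_i s i i l x = g l x.
Proof. by have /rowP/(_ l) := u_solution x; rewrite !mxE. Qed.

Let cU l : continuous (U l).
Proof. exact: C1_continuous (C2_component l u_C2).1. Qed.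

Let cp i l : continuous (p i l).
Proof. exact: ((C2_component l u_C2).1 i).2. Qed.

Let cs i j l : continuous (s i j l).
Proof. exact: ((C2_component l u_C2).2 j i).2. Qed.

Let cu : continuous u.
Proof. by apply: cont_vector. Qed.

Let cg l : continuous (g l).
Proof. exact: (cont_comp (W_C1 l).2 cu). Qed.

Let cw : continuous w.
Proof. exact: (cont_comp (C1_continuous W_C1) cu). Qed.

Lemma energy_densityE x : e x = 2^-1 * sqnorm_grad u x + W (u x).
Proof. by []. Qed.

Lemma cont_sqnorm_grad : continuous (sqnorm_grad u).
Proof. by apply: cont_sum => l; apply: cont_sum => i; apply: cont_exp; exact: cp. Qed.

Lemma cont_energy_density : continuous e.
Proof.
apply: cont_add; last exact: cw.
by apply: cont_mul; [exact: cont_cst|exact: cont_sqnorm_grad].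
Qed.

Let cX c i : continuous (fun x : 'rV[R]_n => x 0 i - c 0 i).
Proof. by apply: cont_sub; [exact: cont_coord|exact: cont_cst]. Qed.

Let de j x := \sum_l \sum_i p i l x * s j i l x + \sum_l p j l x * g l x.

Let deriv_e j x : is_derive x (basis_vec j) e (de j x).
Proof.
have S := deriv_sum (fun l => deriv_sum (fun i => deriv_sqr (deriv_p j i l x))).
apply: (is_derive_eq (deriv_add (deriv_scale 2^-1 S) (deriv_w j x))).
rewrite /de; congr (_ + _); rewrite mulr_sumr; apply: eq_bigr => l _.
by rewrite mulr_sumr; apply: eq_bigr => i _; rewrite mulKf.
Qed.

(* Pohozaev's identity: the stress tensor is divergence free, and is tested
   against the radial field [cutoff ^+ 2 * (x - c)]. *)
Lemma pohozaev c r : 0 <= r ->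
  (n%:R + 2) * Rintegral_Rn (fun x => cutoff c r x ^+ 2 * e x) +
  2 * Rintegral_Rn (fun x => cutoff c r x ^+ 2 * w x) <=
  4 * r ^+ 2 * Rintegral_Rn (fun x => cutoff c r x * e x).
Proof.
move=> r0.
pose X x i := x 0 i - c 0 i.
pose Z l x := \sum_i X x i * p i l x.
pose q x := cutoff c r x.
have tq : test_fun q := test_fun_cutoff c r0.
have th : test_fun (fun x => q x ^+ 2) := test_fun_cutoff2 c r0.
have ce := cont_energy_density.
have cXx i : continuous (X^~ i) by exact: cX.
have cZ l : continuous (Z l).
  by apply: cont_sum => i; apply: cont_mul; [exact: cXx|exact: cp].
pose dZ j l x := \sum_i ((i == j)%:R * p i l x + X x i * s j i l x).
have deriv_Z j l x : is_derive x (basis_vec j) (Z l) (dZ j l x).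
  apply: (is_derive_eq (deriv_sum (fun i => deriv_mul (deriv_sub
    (deriv_coord i x (basis_vec j)) (deriv_cst (c 0 i) _ _)) (deriv_p j i l x)))).
  by apply: eq_bigr => i _; rewrite basis_vecE subr0.
(* The stress tensor contracted with the radial field. *)
pose T j x := \sum_l Z l x * p j l x - e x * X x j.
pose dT j x := \sum_l (dZ j l x * p j l x + Z l x * s j j l x) - (de j x * X x j + e x).
have deriv_T j x : is_derive x (basis_vec j) (T j) (dT j x).
  apply: (is_derive_eq (deriv_sub
    (deriv_sum (fun l => deriv_mul (deriv_Z j l x) (deriv_p j j l x)))
    (deriv_mul (deriv_e j x) (deriv_sub (deriv_coord j x (basis_vec j))
      (deriv_cst (c 0 j) _ _))))).
  by rewrite basis_vecE eqxx subr0 mulr1.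
have cT j : continuous (T j).
  apply: cont_sub; last by apply: cont_mul; [exact: ce|exact: cXx].
  by apply: cont_sum => l; apply: cont_mul; [exact: cZ|exact: cp].
have cdZ j l : continuous (dZ j l).
  apply: cont_sum => i; apply: cont_add; apply: cont_mul.
  - exact: cont_cst.
  - exact: cp.
  - exact: cXx.
  - exact: cs.
have cde j : continuous (de j).
  apply: cont_add; last by apply: cont_sum => l; apply: cont_mul; [exact: cp|exact: cg].
  by apply: cont_sum => l; apply: cont_sum => i; apply: cont_mul; [exact: cp|exact: cs].
have cdT j : continuous (dT j).
  apply: cont_sub.
    apply: cont_sum => l; apply: cont_add; apply: cont_mul.
    - exact: cdZ.
    - exact: cp.
    - exact: cZ.
    - exact: cs.
  by apply: cont_add => //; apply: cont_mul; [exact: cde|exact: cXx].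
pose F j x := - 4 * q x * X x j * T j x + q x ^+ 2 * dT j x.
have deriv_F j x : is_derive x (basis_vec j) (fun x => q x ^+ 2 * T j x) (F j x).
  exact: (deriv_mul (deriv_cutoff2 c r x j) (deriv_T j x)).
have cF j : continuous (F j).
  apply: cont_add; last by apply: cont_mul; [exact: th.1|exact: cdT].
  apply: cont_mul; last exact: cT.
  apply: cont_mul; last exact: cXx.
  by apply: cont_mul; [exact: cont_cst|exact: tq.1].
have sF j : compact_supp (fun x => q x ^+ 2 * T j x) := (test_fun_mul th (cT j)).2.
have tF j : test_fun (F j) := test_fun_partial (deriv_F j) (cF j) (sF j).
have I0 : Rintegral_Rn (fun x => \sum_j F j x) = 0.
  rewrite Rintegral_Rn_sum//.
  by rewrite big1// => j _; exact: Rintegral_Rn_partial (deriv_F j) (cF j) (sF j).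
have t1 : test_fun (fun x => q x * e x) := test_fun_mul tq ce.
have t2 : test_fun (fun x => q x ^+ 2 * e x) := test_fun_mul th ce.
have t3 : test_fun (fun x => q x ^+ 2 * w x) := test_fun_mul th cw.
pose G x := 4 * r ^+ 2 * (q x * e x) +
  (- (n%:R + 2) * (q x ^+ 2 * e x) + - 2 * (q x ^+ 2 * w x)).
have tG23 : test_fun (fun x => - (n%:R + 2) * (q x ^+ 2 * e x) + - 2 * (q x ^+ 2 * w x)).
  by apply: test_fun_add; exact: test_fun_scale.
have tG : test_fun G by apply: test_fun_add => //; exact: test_fun_scale.
have : Rintegral_Rn (fun x => \sum_j F j x) <= Rintegral_Rn G.
  apply: Rintegral_Rn_le => //; first exact: test_fun_sum.
  move=> x.
  have := @stress_divergence R n m (X x) (fun i l => p i l x)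
    (fun i j l => s i j l x) (fun l => g l x) (q x) (q x ^+ 2) (e x)
    (fun i j l => s_sym i j l x) (fun l => sum_s l x).
  rewrite /= -/(Z _ x) => E.
  have -> : \sum_j F j x = - 4 * q x * (\sum_l Z l x ^+ 2 - e x * \sum_i X x i ^+ 2) +
     q x ^+ 2 * (sqnorm_grad u x - n%:R * e x).
    rewrite -[RHS]E; apply: eq_bigr => j _; congr (_ + _ * (_ - _)).
  have -> : \sum_i X x i ^+ 2 = dotv (x - c) (x - c).
    by apply: eq_bigr => i _; rewrite !mxE expr2.
  have -> : sqnorm_grad u x = 2 * e x - 2 * w x.
    by rewrite energy_densityE /w; move: (sqnorm_grad u x) (W (u x)) => a b; field.
  have D := cutoff_dist2 c r x; rewrite -/(q x) in D.
  (* The term in the radial derivatives [Z] enters with a minus sign; dropping it turns the identity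
     into an inequality. *)
  have P : 0 <= q x * \sum_l Z l x ^+ 2.
    by rewrite mulr_ge0 ?cutoff_ge0// sumr_ge0// => l _; rewrite sqr_ge0.
  have {}D : e x * (q x * dotv (x - c) (x - c)) = e x * (r ^+ 2 * q x - q x ^+ 2).
    by rewrite D.
  rewrite /G; move: (q x) (e x) (dotv _ _) (\sum_l _) (w x) (n%:R) D P.
  move=> q' e' d z w' n'; lra.
rewrite I0 /G Rintegral_Rn_add//; last exact: test_fun_scale.
rewrite Rintegral_Rn_add; [|exact: test_fun_scale|exact: test_fun_scale].
rewrite !Rintegral_Rn_scale// /q.
move: (Rintegral_Rn _) (Rintegral_Rn _) (Rintegral_Rn _) => a b d; lra.
Qed.

Let y (a : 'rV[R]_m) l x := U l x - a 0 l.
(** [ps] is supported where [u] is close to [a]; [yp] below is half the i-th derivative of |u -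
    a|^2. *)
Let ps (a : 'rV[R]_m) (d : R) x := Num.max 0 (d - \sum_l y a l x ^+ 2).
Let yp (a : 'rV[R]_m) i x := \sum_l y a l x * p i l x.

(* First and second derivatives of [- d ^- 2 * max 0 (d - |u - a| ^ 2) ^ 3]. *)
Let dP a (d : R) i x : R := 6 / d ^+ 2 * (ps a d x ^+ 2 * yp a i x).
Let ddP a (d : R) i x : R := 6 / d ^+ 2 *
  (- 4 * ps a d x * yp a i x * yp a i x +
   ps a d x ^+ 2 * \sum_l (p i l x * p i l x + y a l x * s i i l x)).

Let cy a l : continuous (y a l).
Proof. by apply: cont_sub; [exact: cU|exact: cont_cst]. Qed.

Let cps a d : continuous (ps a d).
Proof.
apply: cont_pos; apply: cont_sub; first exact: cont_cst.
by apply: cont_sum => l; apply: cont_exp; exact: cy.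
Qed.

Let cyp a i : continuous (yp a i).
Proof. by apply: cont_sum => l; apply: cont_mul; [exact: cy|exact: cp]. Qed.

Let cdP a d i : continuous (dP a d i).
Proof.
apply: cont_mul; first exact: cont_cst.
by apply: cont_mul; [apply: cont_exp; exact: cps|exact: cyp].
Qed.

Let cddP a d i : continuous (ddP a d i).
Proof.
apply: cont_mul; first exact: cont_cst.
apply: cont_add.
  apply: cont_mul; last exact: cyp.
  apply: cont_mul; last exact: cyp.
  by apply: cont_mul; [exact: cont_cst|exact: cps].
apply: cont_mul; first by apply: cont_exp; exact: cps.
apply: cont_sum => l; apply: cont_add; apply: cont_mul.
- exact: cp.
- exact: cp.
- exact: cy.
- exact: cs.
Qed.

Let deriv_dP a d i x : is_derive x (basis_vec i) (dP a d i) (ddP a d i x).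
Proof.
have Dy l := deriv_sub (deriv_U i l x) (deriv_cst (a 0 l) x (basis_vec i)).
have S := deriv_sub (deriv_cst d x (basis_vec i)) (deriv_sum (fun l => deriv_sqr (Dy l))).
have Dps := is_derive_comp1 (deriv_pos_sqr _) S.
have Dyp := deriv_sum (fun l => deriv_mul (Dy l) (deriv_p i i l x)).
apply: (is_derive_eq (deriv_scale (6 / d ^+ 2) (deriv_mul Dps Dyp))).
rewrite /ddP; congr (_ * (_ + _ * _)); last first.
  by apply: eq_bigr => l _; rewrite subr0.
rewrite -mulr_sumr -/(y _ _ _) sub0r.
have -> : \sum_l y a l x * (p i l x - 0) = yp a i x.
  by apply: eq_bigr => l _; rewrite subr0.
by rewrite -/(ps a d x) -/(yp a i x); ring.
Qed.

(** The system enters here: the Laplacian of [u] turns into the gradient of [W], paired with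
    [u - a], which is nonnegative near a well. *)
Let sum_ddP a d x : \sum_i ddP a d i x = 6 / d ^+ 2 *
  (- 4 * ps a d x * (\sum_i yp a i x ^+ 2) + ps a d x ^+ 2 *
    (sqnorm_grad u x + dotv (gradient W (u x)) (u x - a))).
Proof.
rewrite -mulr_sumr big_split /= -mulr_sumr; congr (_ * (_ + _)).
  by rewrite mulr_sumr; apply: eq_bigr => i _; ring.
congr (_ * _); rewrite exchange_big /= -big_split /=.
apply: eq_bigr => l _; rewrite big_split /= -mulr_sumr sum_s; congr (_ + _).
by rewrite !mxE mulrC.
Qed.

Let sqnorm_grad_ge0 x : 0 <= sqnorm_grad u x.
Proof. by apply: sumr_ge0 => l _; apply: sumr_ge0 => i _; exact: sqr_ge0. Qed.

Let sum_y a x : \sum_l y a l x ^+ 2 = dotv (u x - a) (u x - a).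
Proof. by apply: eq_bigr => l _; rewrite !mxE expr2. Qed.

Let sum_p i x : \sum_l p i l x ^+ 2 <= sqnorm_grad u x.
Proof.
rewrite /sqnorm_grad exchange_big (bigD1 i)//= lerDl.
by apply: sumr_ge0 => k _; apply: sumr_ge0 => l _; exact: sqr_ge0.
Qed.

Let sum_yp a x : \sum_i yp a i x ^+ 2 <= dotv (u x - a) (u x - a) * sqnorm_grad u x.
Proof.
rewrite /sqnorm_grad exchange_big mulr_sumr; apply: ler_sum => i _ /=.
by rewrite -sum_y; exact: cauchy_schwarz.
Qed.

Let yp_le a i x : `|yp a i x| <= 2^-1 * (dotv (u x - a) (u x - a) + sqnorm_grad u x).
Proof.
apply: (@le_trans _ _ (2^-1 * (\sum_l y a l x ^+ 2 + \sum_l p i l x ^+ 2))).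
  rewrite -big_split mulr_sumr; apply: (le_trans (ler_norm_sum _ _ _)).
  apply: ler_sum => l _ /=; rewrite normrM.
  rewrite -[y a l x ^+ 2]real_normK ?num_real// -[p i l x ^+ 2]real_normK ?num_real//.
  by move: `|y a l x| `|p i l x| => b t; have := sqr_ge0 (b - t); rewrite sqrrB; lra.
by rewrite ler_pM2l// sum_y lerD2l sum_p.
Qed.

(** Let S = |u - a|^2. For S <= d / 8 the Laplacian dominates |grad u|^2; for d / 8 < S < d its
    negative part is at most 24 G while W(u) >= k d / 8; for S >= d the potential vanishes with its
    derivatives. *)
Let well_potential (a : 'rV[R]_m) (d k G : R) : 0 < d -> 0 < k ->
  (forall v, 0 <= W v) -> (forall x, sqnorm_grad u x <= G) ->
  (forall v, dotv (v - a) (v - a) < d ->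
    k * dotv (v - a) (v - a) <= W v /\ 0 <= dotv (gradient W v) (v - a)) ->
  exists2 C : R, 0 <= C & forall x,
    [/\ dotv (u x - a) (u x - a) <= d / 8 ->
          sqnorm_grad u x <= \sum_i ddP a d i x + C * w x,
        0 <= \sum_i ddP a d i x + C * w x &
        forall i, `|dP a d i x| <= C * e x].
Proof.
move=> d0 k0 W0 uG well.
have G0 : 0 <= G := le_trans (sqnorm_grad_ge0 0) (uG 0).
(* This is 24 G divided by the lower bound k d / 8 of W(u) in the intermediate zone. *)
pose C1 := 192 * G / (k * d).
have C10 : 0 <= C1 by rewrite divr_ge0 ?mulr_ge0// ltW.
have k30 : 0 <= 3 / k by rewrite divr_ge0// ltW.
(* The second summand controls the gradient: |dP| <= 6 |yp| <= 3 (S + |grad u|^2), with S <= e / k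
   and |grad u|^2 <= 2 e. *)
exists (C1 + (3 / k + 6)); first by rewrite !addr_ge0.
move=> x; have w0 : 0 <= w x := W0 _.
have Cw0 : 0 <= (3 / k + 6) * w x by rewrite mulr_ge0// addr_ge0.
have C1w0 : 0 <= C1 * w x by rewrite mulr_ge0.
have Cd z : (C1 + (3 / k + 6)) * z = C1 * z + (3 / k + 6) * z by rewrite mulrDl.
have g0 := sqnorm_grad_ge0 x.
have we : w x <= e x by rewrite energy_densityE lerDr mulr_ge0.
have ge : sqnorm_grad u x <= 2 * e x.
  by rewrite energy_densityE -/(w x); move: (w x) w0 => w' w0; lra.
have e0 : 0 <= e x := le_trans w0 we.
rewrite sum_ddP /dP; set S := dotv (u x - a) (u x - a).
have S0 : 0 <= S := dotv_ge0 _.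
have [Sd|dS] := ltP S d; last first.
  have -> : ps a d x = 0 by apply: max_l; rewrite sum_y subr_le0.
  rewrite expr0n /= !(mulr0, mul0r, add0r, addr0); split => [Sd8||i].
  - by move: dS Sd8 d0; lra.
  - by rewrite Cd addr_ge0.
  - by rewrite mul0r mulr0 normr0 mulr_ge0// !addr_ge0.
have [kS gy] := well _ Sd; rewrite -/S -/(w x) in kS.
have psE : ps a d x = d - S.
  by rewrite /ps sum_y -/S max_r// subr_ge0 ltW.
have q0 : 0 < d - S by rewrite subr_gt0.
rewrite psE; set t := d - S in q0 *.
have td : t <= d by rewrite /t; lra.
have sp := sum_yp a x; rewrite -/S in sp.
have Y0 : 0 <= \sum_i yp a i x ^+ 2 by apply: sumr_ge0 => i _; exact: sqr_ge0.
have dd : 0 < d ^+ 2 by exact: exprn_gt0.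
set Y := \sum_i _ in sp Y0 *; set gr := sqnorm_grad u x in g0 ge sp *.
set D := dotv _ (u x - a) in gy *.
(* Cauchy-Schwarz bounds [Y] by [S * gr] and [D] is nonnegative, so the sign of [t - 4 * S]
   decides. *)
have low : 6 / d ^+ 2 * (t * gr * (t - 4 * S)) <=
    6 / d ^+ 2 * (- 4 * t * Y + t ^+ 2 * (gr + D)).
  rewrite ler_pM2l ?divr_gt0//.
  have h1 : 0 <= t * (S * gr - Y) by rewrite mulr_ge0 ?subr_ge0// ltW.
  have h2 : 0 <= t ^+ 2 * D by rewrite mulr_ge0// sqr_ge0.
  by move: h1 h2; move: (t) (gr) (S) (Y) (D) => t' gr' S' Y' D'; lra.
(* Here t >= 7 d / 8 and t - 4 S >= 3 d / 8, and 6 (7 / 8) (3 / 8) exceeds 1. *)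
have small : S <= d / 8 -> gr <= 6 / d ^+ 2 * (t * gr * (t - 4 * S)).
  move=> Sd8.
  have -> : 6 / d ^+ 2 * (t * gr * (t - 4 * S)) = gr * (6 * (t * (t - 4 * S)) / d ^+ 2).
    by field; rewrite gt_eqF.
  rewrite ler_peMr// ler_pdivlMr// mul1r.
  have h1 : 7 / 8 * d <= t by rewrite /t; lra.
  have h2 : 3 / 8 * d <= t - 4 * S by rewrite /t; lra.
  have h3 : (7 / 8 * d) * (3 / 8 * d) <= t * (t - 4 * S) by apply: ler_pM => //; lra.
  by move: h3 (sqr_ge0 d); move: (t * (t - 4 * S)) => z; rewrite expr2; lra.
split => [Sd8||i].
- by apply: (le_trans (small Sd8)); apply: (le_trans low); rewrite Cd lerDl addr_ge0.
- have [Sd8|Sd8] := leP S (d / 8).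
    rewrite Cd !addr_ge0//; apply: le_trans low; apply: le_trans (small Sd8).
    exact: g0.
  rewrite Cd addrA addr_ge0//.
  have h1 : - (24 * G) <= 6 / d ^+ 2 * (t * gr * (t - 4 * S)).
    have -> : 6 / d ^+ 2 * (t * gr * (t - 4 * S)) = 6 * (t * gr * (t - 4 * S)) / d ^+ 2.
      by field; rewrite gt_eqF.
    rewrite ler_pdivlMr//.
    have h : t * (S * gr) <= d * (d * G).
      apply: ler_pM; [exact: ltW|exact: mulr_ge0|exact: td|].
      by apply: ler_pM => //; [exact: ltW|exact: uG].
    have h' : 0 <= t * (t * gr) by rewrite !mulr_ge0// ltW.
    by move: h h'; rewrite expr2; move: (t) (gr) (S) => t' gr' S'; lra.
  have h2 : 24 * G <= C1 * w x.
    have : 24 * G = C1 * (k * (d / 8)) by rewrite /C1; field; rewrite !gt_eqF.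
    move=> ->; rewrite ler_wpM2l//; apply: le_trans kS.
    by rewrite ler_pM2l// ltW.
  by move: (le_trans h1 low) h2; move: (6 / _ * _) (C1 * _) => z1 z2; lra.
- rewrite Cd; apply: (@le_trans _ _ ((3 / k + 6) * e x)); last first.
    by rewrite lerDr mulr_ge0.
  have n1 : `|6 / d ^+ 2| = 6 / d ^+ 2 by rewrite gtr0_norm// divr_gt0.
  have n2 : `|t ^+ 2| = t ^+ 2 by rewrite ger0_norm// sqr_ge0.
  rewrite normrM n1 normrM n2.
  have h : t ^+ 2 <= d ^+ 2.
    by rewrite ler_pXn2r// nnegrE; exact: ltW.
  apply: (@le_trans _ _ (6 / d ^+ 2 * (d ^+ 2 * `|yp a i x|))).
    by rewrite ler_pM2l ?divr_gt0// ler_wpM2r.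
  rewrite mulrA divfK ?gt_eqF//.
  have h1 := yp_le a i x; rewrite -/S -/gr in h1.
  have h2 : S <= k^-1 * e x.
    by rewrite ler_pdivlMl// (le_trans kS).
  by move: h1 h2 ge; move: (k^-1) `|_| (S) (gr) (e x) => k' z S' gr' e'; lra.
Qed.

(** Since [u] is bounded, the gradient of [W] along [u] is bounded; it is the Laplacian of [u], so
    the interior gradient bound applies to each component. *)
Lemma sqnorm_grad_bounded (M : R) : (forall x, enorm (u x) <= M) ->
  exists G, forall x, sqnorm_grad u x <= G.
Proof.
move=> uM.
have gK l : exists K : R, forall x, `|g l x| <= K.
  have [K KP] := bounded_on_enorm_ball M (W_C1 l).2.
  by exists K => x; exact: KP.
have [K KP] := choice gK.
exists (\sum_l \sum_(i < n) (M * n.+1%:R + (K l + 1) / 2) ^+ 2) => x.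
apply: ler_sum => l _; apply: ler_sum => i _.
rewrite -[X in X <= _]real_normK ?num_real//.
have B : `|partial i (component u l) x| <= M * n.+1%:R + (K l + 1) / 2.
  apply: C2_gradient_bound_norm => [|z|z]; first exact: C2_component.
    exact: le_trans (coord_le_enorm (u z) l) (uM z).
  by have := KP l z; rewrite -sum_s.
by rewrite ler_pXn2r// nnegrE// (le_trans (normr_ge0 _) B).
Qed.

(** The potentials of all wells are added. Near one well its own potential dominates |grad u|^2 and
    the others cost multiples of W(u); away from all wells W(u) >= w0 dominates directly. Green's
    formula converts the Laplacians into the term in [r]. *)
Lemma energy_inequality (N : nat) (a : 'I_N -> 'rV[R]_m) (d k : 'I_N -> R) (G w0 : R) :
  (forall v, 0 <= W v) -> (forall x, sqnorm_grad u x <= G) ->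
  (forall t, 0 < d t) -> (forall t, 0 < k t) ->
  (forall t v, dotv (v - a t) (v - a t) < d t ->
    k t * dotv (v - a t) (v - a t) <= W v /\
    0 <= dotv (gradient W v) (v - a t)) ->
  0 < w0 ->
  (forall x, (forall t, d t / 8 < dotv (u x - a t) (u x - a t)) -> w0 <= W (u x)) ->
  exists C1 C2 : R, [/\ 0 < C1, 0 <= C2 & forall c r, 0 <= r ->
    Rintegral_Rn (fun x => cutoff c r x ^+ 2 * e x) <=
    C1 * Rintegral_Rn (fun x => cutoff c r x ^+ 2 * w x) +
    C2 * r * Rintegral_Rn (fun x => cutoff c r x * e x)].
Proof.
move=> W0 uG d0 k0 well w00 away.
have [C] := choice (fun t => ex2_and (well_potential (d0 t) (k0 t) W0 uG (well t))).
move=> CP.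
have C0 t : 0 <= C t by have [] := CP t.
have G0 : 0 <= G := le_trans (sqnorm_grad_ge0 0) (uG 0).
(* The last summand serves the region away from the wells: there (G / w0) W(u) >= G >= |grad
   u|^2. *)
pose A := \sum_t C t + G / w0.
have SC0 : 0 <= \sum_t C t by exact: sumr_ge0.
have Gw0 : 0 <= G / w0 by rewrite divr_ge0// ltW.
pose L x := \sum_t \sum_i ddP (a t) (d t) i x.
have bound x : sqnorm_grad u x <= L x + A * w x.
  have wx0 : 0 <= w x := W0 _.
  have Lsplit : L x + (\sum_t C t) * w x = \sum_t (\sum_i ddP (a t) (d t) i x + C t * w x).
    by rewrite big_split /= mulr_suml.
  rewrite /A mulrDl addrA Lsplit.
  have pos t : 0 <= \sum_i ddP (a t) (d t) i x + C t * w x.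
    by have [_ /(_ x)[]] := CP t.
  have [[t tx]|none] := pselect (exists t, dotv (u x - a t) (u x - a t) <= d t / 8).
    have [_ /(_ x)[/(_ tx) H _ _]] := CP t.
    apply: (le_trans H); rewrite (bigD1 t)//= -addrA lerDl addr_ge0//.
      exact: sumr_ge0.
    exact: mulr_ge0.
  have w0x : w0 <= W (u x).
    by apply: away => t; rewrite ltNge; apply/negP => tx; apply: none; exists t.
  apply: (le_trans (uG x)); rewrite -[X in X <= _]add0r lerD ?sumr_ge0//.
  by rewrite mulrAC ler_pdivlMr// ler_wpM2l.
(* The halves come from the factor 1 / 2 before |grad u|^2 in the energy, the 1 from its potential
   part; 2 n is half of 4 n, with 4 from Green's formula and [n] from bounding each coordinate by
   [r]. *)
exists (A / 2 + 1), (2 * n%:R * \sum_t C t); split.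
- by rewrite ltr_wpDl// divr_ge0// addr_ge0.
- by rewrite !mulr_ge0.
move=> c r r0.
pose q x := cutoff c r x.
have tq : test_fun q := test_fun_cutoff c r0.
have th : test_fun (fun x => q x ^+ 2) := test_fun_cutoff2 c r0.
have ce := cont_energy_density.
have cL t : continuous (fun x => \sum_i ddP (a t) (d t) i x).
  by apply: cont_sum => i; exact: cddP.
have t1 : test_fun (fun x => q x * e x) := test_fun_mul tq ce.
have t2 : test_fun (fun x => q x ^+ 2 * e x) := test_fun_mul th ce.
have t3 : test_fun (fun x => q x ^+ 2 * w x) := test_fun_mul th cw.
have t4 t : test_fun (fun x => q x ^+ 2 * \sum_i ddP (a t) (d t) i x).
  exact: test_fun_mul th (cL t).
have t5 : test_fun (fun x => \sum_t q x ^+ 2 * \sum_i ddP (a t) (d t) i x).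
  exact: test_fun_sum.
have green t : Rintegral_Rn (fun x => q x ^+ 2 * \sum_i ddP (a t) (d t) i x) <=
    4 * (n%:R * r * C t * Rintegral_Rn (fun x => q x * e x)).
  rewrite (green_cutoff c r0 (@deriv_dP (a t) (d t)) (@cdP (a t) (d t)) (@cddP (a t) (d t))).
  rewrite ler_pM2l// -Rintegral_Rn_scale//; apply: Rintegral_Rn_le.
  - apply: test_fun_mul => //; apply: cont_sum => i.
    by apply: cont_mul; [exact: cX|exact: cdP].
  - exact: test_fun_scale.
  move=> x; rewrite mulr_sumr.
  have -> : n%:R * r * C t * (q x * e x) = \sum_(i < n) (q x * r * (C t * e x)).
    by rewrite sumr_const card_ord -mulr_natl; ring.
  apply: ler_sum => i _; rewrite mulrA; apply: (le_trans (ler_norm _)).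
  rewrite normrM normrM [`|cutoff _ _ _|]ger0_norm ?cutoff_ge0//.
  apply: ler_pM => //; first by rewrite mulr_ge0// cutoff_ge0.
    exact: cutoff_coord.
  by have [_ /(_ x)[_ _]] := CP t.
apply: (@le_trans _ _ (Rintegral_Rn (fun x =>
    2^-1 * (\sum_t q x ^+ 2 * \sum_i ddP (a t) (d t) i x) +
    (A / 2 + 1) * (q x ^+ 2 * w x)))).
  apply: Rintegral_Rn_le => //.
    by apply: test_fun_add; exact: test_fun_scale.
  move=> x; rewrite -mulr_sumr -/(L x) energy_densityE -/(w x) -/(q x).
  have h : 0 <= q x ^+ 2 * (L x + A * w x - sqnorm_grad u x).
    by rewrite mulr_ge0 ?sqr_ge0// subr_ge0.
  by move: h; move: (q x ^+ 2) (L x) (w x) (sqnorm_grad u x) => q' l' w' s'; lra.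
rewrite Rintegral_Rn_add; [|exact: test_fun_scale|exact: test_fun_scale].
rewrite !Rintegral_Rn_scale// Rintegral_Rn_sum// addrC lerD2l.
apply: (@le_trans _ _ (2^-1 * \sum_t 4 * (n%:R * r * C t * Rintegral_Rn (fun x => q x * e x)))).
  by rewrite ler_pM2l//; apply: ler_sum => t _; exact: green.
rewrite -mulr_sumr -mulr_suml -mulr_sumr /q.
move: (Rintegral_Rn _) (\sum_t _) => I S.
by rewrite le_eqVlt; apply/orP; left; apply/eqP; field.
Qed.

End System.

(** * Energy growth *)

Section Growth.
Context {R : realType}.
Implicit Types (A B : R -> R).

(* A discrete Gronwall argument along [expR tau ^+ j * r1]. *)
Lemma exponential_growth A B (kappa delta C r0 : R) :
  0 <= kappa -> 0 < delta -> 0 <= C -> 0 < r0 -> 0 < A r0 ->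
  (forall r, 0 <= r -> 0 <= B r) ->
  (forall r, 0 <= r -> (kappa + delta) * A r <= (4 * r ^+ 2 + C * r) * B r) ->
  (forall r r', 0 <= r -> r <= r' -> A r + 2 * (r' ^+ 2 - r ^+ 2) * B r <= A r') ->
  exists c r1 : R, [/\ 0 < c, 0 < r1 &
    forall r, r1 <= r -> c * expR ((kappa + delta / 4) * ln r) <= A r].
Proof.
move=> ka0 de0 C0 r00 Ar0 B0 AB AA.
(* Absorbing the lower-order term [C * r] lowers the exponent to [al]; the passage to finite steps
   lowers it to [ga]. *)
pose al := kappa + delta / 2; pose ga := kappa + delta / 4.
have al0 : 0 < al by rewrite /al; lra.
have ga0 : 0 < ga by rewrite /ga; lra.
have gal : ga < al by rewrite /ga /al; lra.
have Amono r r' : 0 <= r -> r <= r' -> A r <= A r'.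
  move=> rp rr'; apply: le_trans (AA _ _ rp rr'); rewrite lerDl mulr_ge0 ?B0//.
  by rewrite mulr_ge0// subr_ge0 ler_pXn2r// nnegrE (le_trans rp).
(* Beyond this radius al C r <= 2 delta r^2, which is what the absorption requires. *)
pose r1 := Num.max r0 (al * C / (2 * delta)).
have r10 : 0 < r1 by rewrite lt_max r00.
have Ar1 : 0 < A r1 by apply: (lt_le_trans Ar0); apply: Amono; [exact: ltW|rewrite le_max lexx].
have Bge r : r1 <= r -> al * A r <= 4 * r ^+ 2 * B r.
  move=> rr; have rp : 0 < r := lt_le_trans r10 rr.
  have Br := B0 _ (ltW rp).
  have H := AB _ (ltW rp).
  have rC : al * C <= 2 * delta * r.
    by rewrite -ler_pdivrMl ?mulr_gt0// mulrC (le_trans _ rr)// le_max lexx orbT.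
  have h1 : 0 <= (2 * delta * r - al * C) * (r * B r).
    by rewrite mulr_ge0 ?subr_ge0// mulr_ge0// ltW.
  have h2 : al * ((kappa + delta) * A r) <= al * ((4 * r ^+ 2 + C * r) * B r).
    by rewrite ler_pM2l.
  have ad : 0 < kappa + delta by lra.
  rewrite -(ler_pM2l ad); move: h1 h2; rewrite /al.
  move: (A r) (B r) => a b; lra.
(* Chosen so that (1 - tau ga) (1 + tau al) = 1. Then exp(tau ga) <= 1 / (1 - tau ga) = 1 + tau al,
   the growth factor available in one step. *)
pose tau := (al - ga) / (al * ga).
have tau0 : 0 < tau by rewrite divr_gt0 ?subr_gt0 ?mulr_gt0.
have step r : r1 <= r -> expR (tau * ga) * A r <= A (expR tau * r).
  move=> rr; have rp : 0 < r := lt_le_trans r10 rr.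
  have e1 : 1 + tau <= expR tau by exact: expR_ge1Dx.
  have re : r <= expR tau * r by rewrite ler_peMl ?ltW//; lra.
  apply: le_trans (AA _ _ (ltW rp) re).
  have Ar : 0 < A r by apply: (lt_le_trans Ar1); apply: Amono => //; exact: ltW.
  have h1 : (1 + tau * al) * A r <= A r + 2 * ((expR tau * r) ^+ 2 - r ^+ 2) * B r.
    have h2 : 2 * tau <= expR tau ^+ 2 - 1.
      have : (1 + tau) ^+ 2 <= expR tau ^+ 2 by rewrite ler_pXn2r ?nnegrE ?expR_ge0//; lra.
      by rewrite sqrrD; have := sqr_ge0 tau; lra.
    have h3 : 0 <= (expR tau ^+ 2 - 1 - 2 * tau) * (r ^+ 2 * B r).
      by rewrite mulr_ge0 ?subr_ge0// mulr_ge0 ?sqr_ge0// B0// ltW.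
    have h4 : tau * (al * A r) <= tau * (4 * r ^+ 2 * B r) by rewrite ler_pM2l// Bge.
    rewrite exprMn; move: (expR tau ^+ 2) h3 h4 => E.
    move: (A r) (B r) (r ^+ 2) => a b r2; lra.
  apply: le_trans h1; rewrite ler_pM2r//.
  have x1 : tau * ga = 1 - ga / al by rewrite /tau; field; rewrite !gt_eqF.
  have e2 : 1 - tau * ga <= expR (- (tau * ga)) by have := expR_ge1Dx (- (tau * ga)).
  have p : 0 < 1 - tau * ga by rewrite x1 opprB addrC subrK divr_gt0.
  have -> : 1 + tau * al = (1 - tau * ga)^-1.
    apply: (mulIf (lt0r_neq0 p)); rewrite mulVf ?lt0r_neq0// x1 /tau.
    by field; rewrite !gt_eqF.
  by rewrite -[expR _]invrK -expRN lef_pV2 ?posrE ?expR_gt0.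
have iter j : expR (j%:R * (tau * ga)) * A r1 <= A (expR (j%:R * tau) * r1).
  elim: j => [|j IH]; first by rewrite !mul0r expR0 !mul1r.
  rewrite -natr1 !mulrDl !mul1r [_ + tau]addrC !expRD.
  rewrite -[expR tau * _ * _]mulrA; apply: le_trans (step _ _); last first.
    by apply: ler_peMl; [exact: ltW|rewrite -expR0 ler_expR mulr_ge0// ltW].
  by rewrite [expR (_ * _) * expR _]mulrC -mulrA ler_pM2l ?expR_gt0.
(* The [tau] pays for the incomplete last step between the geometric sequence and [r]. *)
exists (expR (- (ga * (ln r1 + tau))) * A r1), r1; split => //.
  by rewrite mulr_gt0 ?expR_gt0.
move=> r rr; have rp : 0 < r := lt_le_trans r10 rr.
pose y := (ln r - ln r1) / tau.
have y0 : 0 <= y by rewrite divr_ge0 ?(ltW tau0)// subr_ge0 ler_ln.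
pose j := Num.truncn y.
have /andP[j1 j2] : j%:R <= y < j.+1%:R by exact: truncn_itv.
have jr : expR (j%:R * tau) * r1 <= r.
  rewrite -{1}(lnK (x := r1)) ?posrE// -expRD -[leRHS]lnK ?posrE// ler_expR.
  by rewrite -lerBrDr -ler_pdivlMr.
apply: le_trans (Amono _ _ _ jr); last by rewrite mulr_ge0 ?expR_ge0// ltW.
apply: le_trans (iter j); rewrite mulrAC ler_pM2r// -expRD ler_expR -/ga.
have h : ln r - ln r1 <= (j%:R + 1) * tau by rewrite natr1 -ler_pdivrMr// ltW.
have : 0 <= ga * ((j%:R + 1) * tau - (ln r - ln r1)) by rewrite mulr_ge0 ?subr_ge0// ltW.
by move: (ln r) (ln r1) (j%:R) => a b j'; lra.
Qed.

(** Multiply 1 + ln z <= z at z = eps y / k by [k] and exponentiate; the constant is the maximum of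
    y^k exp(- eps y). *)
Lemma power_le_exp (k eps : R) : 0 < k -> 0 < eps ->
  exists2 C : R, 0 < C & forall y, 0 < y -> y `^ k <= C * expR (eps * y).
Proof.
move=> k0 e0; have ek : 0 < eps / k by rewrite divr_gt0.
exists (expR (- (k * (1 + ln (eps / k))))); first exact: expR_gt0.
move=> y y0; rewrite /powR gt_eqF// -expRD ler_expR.
have : 1 + ln (eps / k * y) <= eps / k * y.
  by have := expR_ge1Dx (ln (eps / k * y)); rewrite lnK// posrE mulr_gt0.
rewrite lnM ?posrE// => H.
have : k * (1 + (ln (eps / k) + ln y)) <= k * (eps / k * y) by rewrite ler_pM2l.
have -> : k * (eps / k * y) = eps * y by field; rewrite gt_eqF.
by move: (ln _) (ln y) => a b; lra.
Qed.

End Growth.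

(** * From weighted integrals to the energy of balls *)

Section EnergyBound.
Context {R : realType} {n m : nat}.
Implicit Types (W : 'rV[R]_m -> R) (u : 'rV[R]_n -> 'rV[R]_m).
Local Notation Rn n := (n.-tuple (measurableTypeR R)).

(** Turns nonconstancy of [u] into a point of positive energy density. *)
Lemma constant_of_gradient0 u : C1 u ->
  (forall x, sqnorm_grad u x = 0) -> exists c, forall x, u x = c.
Proof.
move=> uC1 g0; exists (u 0) => x; apply/rowP => l.
have p0 y i : partial i (component u l) y = 0.
  apply/eqP; rewrite -sqrf_eq0 eq_le sqr_ge0 andbT -(g0 y) /sqnorm_grad.
  rewrite (bigD1 l)//= (bigD1 i)//= -addrA lerDl addr_ge0//.
    by apply: sumr_ge0 => k _; exact: sqr_ge0.
  by apply: sumr_ge0 => k _; apply: sumr_ge0 => k' _; exact: sqr_ge0.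
have D y : is_derive y x (component u l) 0.
  apply: (is_derive_eq (deriv_direction y x (C1_component l uC1))).
  by rewrite big1// => i _; rewrite p0 mulr0.
have [s _] := @MVT_along R n (component u l) 0 x 1 (fun=> 0) D.
by rewrite mulr0 scale1r add0r /component => /eqP; rewrite subr_eq0 => /eqP.
Qed.

Lemma eball_open (c : 'rV[R]_n) r : open (eball c r).
Proof.
have [r0|r0] := leP r 0.
  rewrite (_ : eball c r = set0); first exact: open0.
  apply/seteqP; split => // y /= yr.
  by have := lt_le_trans yr r0; rewrite ltNge enorm_ge0.
rewrite (_ : eball c r = [set y | dotv (y - c) (y - c) < r ^+ 2]).
  apply: (@open_comp _ _ (fun y : 'rV[R]_n => dotv (y - c) (y - c)) [set z | z < r ^+ 2]).
    by move=> y _; apply: (cont_comp cont_dotv); exact: cont_translation.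
  exact: open_lt.
apply/seteqP; split => y /=; rewrite /eball/= -sqr_enorm.
  by rewrite ltr_pXn2r// nnegrE ?enorm_ge0// ltW.
by rewrite ltr_pXn2r// nnegrE ?enorm_ge0// ltW.
Qed.

(** [cutoff ^+ 2] is at most r^4 and vanishes off the ball. *)
Lemma energy_ge_cutoff W u c r : 0 < r -> (forall x, 0 <= energy_density W u x) ->
  continuous (energy_density W u) ->
  (((r ^+ 4)^-1 * Rintegral_Rn (fun x => cutoff c r x ^+ 2 * energy_density W u x))%:E
    <= energy W u (eball c r))%E.
Proof.
move=> r0 e0 ce; set e := energy_density W u in e0 ce *.
have tf := test_fun_mul (test_fun_cutoff2 c (ltW r0)) ce.
rewrite -Rintegral_Rn_scale//; set g := fun x => _.
have tg : test_fun g by exact: test_fun_scale.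
have intg := test_fun_integrable tg.
have g0 x : 0 <= g x.
  by rewrite /g mulr_ge0 ?invr_ge0 ?exprn_ge0 ?(ltW r0)// mulr_ge0 ?sqr_ge0.
pose D := @row_of_tuple R n @^-1` eball c r.
have mD : measurable D by apply: measurable_open_Rn; exact: eball_open.
have -> : (Rintegral_Rn g)%:E = (\int[@lebesgue_Rn R n]_t (g (row_of_tuple t))%:E)%E.
  by rewrite /Rintegral_Rn /Rintegral fineK//; exact: (integrable_fin_num measurableT intg).
rewrite (_ : (fun t : Rn n => (g (row_of_tuple t))%:E) =
    (EFin \o (fun t : Rn n => g (row_of_tuple t))) \_ D); last first.
  apply/funext => t; rewrite patchE; case: ifPn => // /negP tD.
  rewrite /= /g cutoff_eq0 ?(ltW r0)//; first by rewrite expr0n mul0r mulr0.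
  by rewrite leNgt; apply/negP => tr; apply: tD; rewrite inE.
rewrite -integral_mkcond /energy /integral_Rn; apply: ge0_le_integral => //.
- by move=> t _; rewrite lee_fin.
- by apply: measurable_funTS; have /integrableP[] := intg.
- by apply/measurable_EFinP; apply: measurable_funTS; exact: measurable_continuous_Rn.
- move=> t _; rewrite lee_fin /g mulrA ler_piMl// mulrC ler_pdivrMr ?exprn_gt0// mul1r.
  have -> : r ^+ 4 = (r ^+ 2) ^+ 2 by rewrite -exprM.
  rewrite ler_pXn2r ?nnegrE ?cutoff_ge0 ?sqr_ge0//.
  by rewrite ge_max sqr_ge0 gerBl dotv_ge0.
Qed.

(** Tangent inequality for the convex function max(0, t - z)^2 of t = r^2, whose derivative is twice
    the cutoff. Integrated against the energy density it replaces A' = 4 r B. *)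
Lemma cutoff_convex (c x : 'rV[R]_n) r r' : 0 <= r -> r <= r' ->
  cutoff c r x ^+ 2 + 2 * (r' ^+ 2 - r ^+ 2) * cutoff c r x <= cutoff c r' x ^+ 2.
Proof.
move=> r0 rr'; rewrite /cutoff; set z := dotv _ _.
have h : r ^+ 2 <= r' ^+ 2 by rewrite ler_pXn2r// nnegrE// (le_trans r0).
have [zr|zr] := leP (r ^+ 2 - z) 0; first by rewrite expr0n mulr0 addr0 sqr_ge0.
rewrite max_r; last by lra.
by have := sqr_ge0 (r' ^+ 2 - r ^+ 2); move: (r ^+ 2) (r' ^+ 2) => a b; lra.
Qed.

(** [W] attains a positive minimum on the compact set of bounded values away from all wells. *)
Lemma wells_bounded_below W (N : nat) (a : 'I_N -> 'rV[R]_m) (d : 'I_N -> R) (M : R) :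
  continuous W -> (forall t, 0 < d t) ->
  (forall v, (forall t, v <> a t) -> 0 < W v) ->
  exists2 w0 : R, 0 < w0 & forall v, enorm v <= M ->
    (forall t, d t / 8 < dotv (v - a t) (v - a t)) -> w0 <= W v.
Proof.
move=> cW d0 pos.
pose K := [set v : 'rV[R]_m | enorm v <= M] `&`
  \bigcap_(t in [set: 'I_N]) [set v : 'rV[R]_m | d t / 8 <= dotv (v - a t) (v - a t)].
have cK : compact K.
  apply: compact_closedI; first exact: compact_enorm_ball.
  apply: closed_bigI => t _.
  apply: (@closed_comp _ _ (fun v : 'rV[R]_m => dotv (v - a t) (v - a t)) [set z | d t / 8 <= z]).
    by move=> v _; apply: (cont_comp cont_dotv); exact: cont_translation.
  exact: closed_ge.
have [K0|noK] := pselect (K !=set0); last first.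
  (* If that set is empty, any positive constant will do. *)
  exists 1 => // v vM vd; case: noK; exists v; split => // t _ /=.
  exact: ltW.
have [c cin cmin] := EVT_min_rV K0 cK (continuous_subspaceT cW).
move: cin; rewrite inE => -[_ cd].
exists (W c); last first.
  by move=> v vM vd; apply: cmin; rewrite inE; split => // t _ /=; exact: ltW.
apply: pos => t ct; have : d t / 8 <= dotv (c - a t) (c - a t) := cd t I.
rewrite ct subrr -(scale0r 0) dotvZ mul0r leNgt.
by rewrite divr_gt0.
Qed.

End EnergyBound.

Theorem theorem1p1 (R : realType) (n m : nat)
    (n_ge2 : (2 <= n)%N) (m_ge2 : (2 <= m)%N)
    (W : 'rV[R]_m -> R) (W_C2 : C2 W)
    (N : nat) (N_ge1 : (1 <= N)%N) (a : 'I_N -> 'rV[R]_m)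
    (W_zero : forall i : 'I_N, W (a i) = 0)
    (W_pos : forall v : 'rV[R]_m, (forall i : 'I_N, v <> a i) -> 0 < W v)
    (W_nondeg : forall (i : 'I_N) (nu : 'rV[R]_m),
        enorm nu = 1 -> 0 < dotv (nu *m hessian W (a i)) nu)
    (u : 'rV[R]_n -> 'rV[R]_m) (u_C2 : C2 u)
    (u_nonconstant : ~ exists c : 'rV[R]_m, forall x, u x = c)
    (u_bounded : exists M : R, forall x, enorm (u x) <= M)
    (u_solution : forall x, vlaplacian u x = gradient W (u x))
    (x : 'rV[R]_n) (k : R) (k_gt0 : 0 < k) :
  (((ln r `^ k)^-1 * (r ^+ (n - 2))^-1)%:E * energy W u (eball x r))%E
    @[r --> +oo%R] --> +oo%E.
Proof.
have W0 v : 0 <= W v.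
  have [[i ->]|nv] := pselect (exists i, v = a i); first by rewrite W_zero.
  by apply: ltW; apply: W_pos => i vi; apply: nv; exists i.
have m0 : (0 < m)%N by exact: leq_trans m_ge2.
have [d dP] := choice (fun i => nondegenerate_well m0 W_C2 W0 (W_zero i) (W_nondeg i)).
have [c cP] := choice dP.
have d0 i : 0 < d i by have [] := cP i.
have c0 i : 0 < c i by have [] := cP i.
have well i := let: And3 _ _ H := cP i in H.
have [M uM] := u_bounded.
have cW : continuous W := C1_continuous W_C2.1.
have [w0 w00 away] := wells_bounded_below M cW d0 W_pos.
have [G uG] := sqnorm_grad_bounded W_C2.1 u_C2 u_solution uM.
have [C1' [C2' [C10 C20 ineq]]] := energy_inequality W_C2.1 u_C2 u_solution
  W0 uG d0 c0 well w00 (fun y => away (u y) (uM y)).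
pose e := energy_density W u.
have ce : continuous e := cont_energy_density W_C2.1 u_C2.
have sg0 y : 0 <= sqnorm_grad u y.
  by apply: sumr_ge0 => l _; apply: sumr_ge0 => i _; exact: sqr_ge0.
have e0 y : 0 <= e y by rewrite addr_ge0// mulr_ge0.
pose A r := Rintegral_Rn (fun y => cutoff x r y ^+ 2 * e y).
pose B r := Rintegral_Rn (fun y => cutoff x r y * e y).
have tA r : 0 <= r -> test_fun (fun y => cutoff x r y ^+ 2 * e y).
  by move=> r0; exact: test_fun_mul (test_fun_cutoff2 x r0) ce.
have tB r : 0 <= r -> test_fun (fun y => cutoff x r y * e y).
  by move=> r0; exact: test_fun_mul (test_fun_cutoff x r0) ce.
have [y0 ey0] : exists y0, 0 < e y0.
  apply: contrapT => ne; apply: u_nonconstant.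
  apply: (constant_of_gradient0 u_C2.1) => y.
  apply/eqP; rewrite eq_le sg0 andbT leNgt; apply/negP => sy.
  by apply: ne; exists y; rewrite ltr_wpDr// mulr_gt0.
(* The ball contains [y0] in its interior, so the cutoff is positive there. *)
pose r0 := enorm (y0 - x) + 1.
have r00 : 0 < r0 by rewrite ltr_wpDl// enorm_ge0.
have A0 : 0 < A r0.
  apply: (@Rintegral_Rn_gt0 _ _ _ y0); first exact: tA (ltW r00).
    by move=> y; rewrite mulr_ge0// sqr_ge0.
  rewrite mulr_gt0// exprn_gt0// lt_max subr_gt0 -sqr_enorm.
  by rewrite ltr_pXn2r ?nnegrE ?enorm_ge0 ?(ltW r00)// ltrDl ltr01 orbT.
have B0 r : 0 <= r -> 0 <= B r.
  by move=> _; apply: Rintegral_ge0 => t _; rewrite mulr_ge0// cutoff_ge0.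
have AA r r' : 0 <= r -> r <= r' -> A r + 2 * (r' ^+ 2 - r ^+ 2) * B r <= A r'.
  move=> rp rr'; rewrite -Rintegral_Rn_scale; last exact: tB.
  rewrite -Rintegral_Rn_add; [|exact: tA|apply: test_fun_scale; exact: tB].
  apply: Rintegral_Rn_le.
  - by apply: test_fun_add; [exact: tA|apply: test_fun_scale; exact: tB].
  - by apply: tA; exact: le_trans rr'.
  by move=> y; rewrite mulrA -mulrDl ler_wpM2r// cutoff_convex.
(* The energy inequality, solved for the integral of q^2 W(u), is inserted into Pohozaev's
   inequality; the gain in the exponent is 2 / C1'. *)
have AB r : 0 <= r ->
    (n%:R + 2 + 2 / C1') * A r <= (4 * r ^+ 2 + 2 * C2' / C1' * r) * B r.
  move=> rp; have P := pohozaev W_C2.1 u_C2 u_solution x rp.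
  have Q := ineq x r rp; rewrite -/(A r) -/(B r) in P Q.
  have H : 2 / C1' * A r - 2 * C2' / C1' * r * B r <=
      2 * Rintegral_Rn (fun y => cutoff x r y ^+ 2 * W (u y)).
    rewrite (_ : _ - _ = 2 * ((A r - C2' * r * B r) / C1')); last by field; rewrite gt_eqF.
    by rewrite ler_pM2l// ler_pdivrMr// [_ * C1']mulrC lerBlDr.
  by move: P H; move: (Rintegral_Rn _) (A r) (B r) (2 / C1') (2 * C2' / C1') => w a' b q1 q2; lra.
have kap0 : 0 <= n%:R + 2 :> R by rewrite addr_ge0.
have de0 : 0 < 2 / C1' by rewrite divr_gt0.
have C30 : 0 <= 2 * C2' / C1' by rewrite divr_ge0 ?mulr_ge0// ltW.
have [b [r1 [b0 r10 growth]]] := exponential_growth kap0 de0 C30 r00 A0 B0 AB AA.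
(* The surplus exponent. One half of it absorbs the power of the logarithm, the other half drives
   the divergence. *)
pose dl := 2 / C1' / 4.
have dl0 : 0 < dl by rewrite divr_gt0.
have [K K0 KP] := power_le_exp k_gt0 (divr_gt0 dl0 (ltr0n _ 2)).
apply/cvgeyPge => L.
(* Beyond the last term, exp((dl / 2) ln r) >= (dl / 2) ln r >= |L| K / b; the bound 1 makes the
   logarithm positive. *)
pose Y := Num.max (Num.max r1 1) (expR (`|L| * K / b / (dl / 2))).
exists Y; split; first exact: num_real.
move=> r; rewrite !gt_max => /andP[/andP[r1r r1'] rL].
have rp : 0 < r by exact: lt_trans ltr01 r1'.
have lr : 0 < ln r by rewrite ln_gt0.
have E := energy_ge_cutoff x rp e0 ce.
have lk0 : 0 < (ln r `^ k)^-1 by rewrite invr_gt0 powR_gt0.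
have rn0 : 0 < (r ^+ (n - 2))^-1 by rewrite invr_gt0 exprn_gt0.
apply: le_trans (lee_wpmul2l _ E); last by rewrite lee_fin mulr_ge0 ?ltW.
rewrite -EFinM lee_fin -/(A r).
have G1 := growth r (ltW r1r).
have rE : r = expR (ln r) by rewrite lnK.
(* Here n + 2 = (n - 2) + 4: one power is the normalisation in the statement, the other cancels the
   r^-4 lost to the cutoff. The natural-number difference is exact because n >= 2. *)
have H1 : expR ((n%:R + 2 + dl) * ln r) = r ^+ (n - 2) * r ^+ 4 * expR (dl * ln r).
  rewrite {2 3}rE -!expRM_natl -!expRD; congr expR.
  by rewrite natrB//; ring.
rewrite H1 in G1.
have H2 : b * expR (dl * ln r) <= (r ^+ (n - 2))^-1 * ((r ^+ 4)^-1 * A r).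
  rewrite ler_pdivlMl ?exprn_gt0// ler_pdivlMl ?exprn_gt0//.
  by apply: le_trans G1; rewrite le_eqVlt; apply/orP; left; apply/eqP; ring.
rewrite -mulrA; apply: (@le_trans _ _ ((ln r `^ k)^-1 * (b * expR (dl * ln r)))); last first.
  by rewrite ler_pM2l.
have H3 := KP _ lr.
rewrite mulrC ler_pdivlMr ?powR_gt0//.
apply: (@le_trans _ _ (`|L| * (K * expR (dl / 2 * ln r)))).
  apply: (@le_trans _ _ (`|L| * ln r `^ k)).
    by rewrite ler_wpM2r ?powR_ge0// ler_norm.
  by rewrite ler_wpM2l.
have -> : expR (dl * ln r) = expR (dl / 2 * ln r) * expR (dl / 2 * ln r).
  by rewrite -expRD; congr expR; field.
rewrite mulrA mulrA ler_pM2r ?expR_gt0// -ler_pdivrMl//.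
apply: le_trans (expR_ge1Dx _); apply: le_trans (_ : dl / 2 * ln r <= _); last by rewrite lerDr.
rewrite -ler_pdivrMl ?divr_gt0// mulrC [b^-1 * _]mulrC.
by rewrite -[leLHS]expRK ler_ln ?posrE ?expR_gt0// ltW.
Qed.
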